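(* Let $\psi\colon\mathbb{N}\to[0,\infty)$ be monotonically decreasing (non-increasing), let $s\ge0$, and let $$W(\psi;\mathbf{Bad};\mathbf{QI})=\{x\in\mathbf{Bad}:\ \exists\,\alpha\in\mathbf{QI}\text{ such that }|T^n(x)-\alpha|<\psi(n)\text{ for infinitely many }n\in\mathbb{N}\}.$$ Then $$\mathcal{H}^s(W(\psi;\mathbf{Bad};\mathbf{QI}))=\begin{cases}0&\text{if for every integer }Q\ge1,\ \displaystyle\sum_{n=1}^\infty\ \sum_{a_1,\dots,a_n=1}^{Q}\frac{\psi(n)^s}{q_n(a_1,\dots,a_n)^{2s}}<\infty,\\[2ex] \infty&\text{if there is an integer }Q\ge1\text{ such that }\displaystyle\sum_{n=1}^\infty\ \sum_{a_1,\dots,a_n=1}^{Q}\frac{\psi(n)^s}{q_n(a_1,\dots,a_n)^{2s}}=\infty.\end{cases}$$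
   Context: $\mathcal{H}^s$ is Hausdorff $s$-measure on $\mathbb{R}$, and $0^0:=0$ when $s=0$. $\mathbf{Bad}$ is the set of badly approximable numbers in $(0,1]$: those $x$ for which there is $c=c(x)>0$ with $|x-p/q|>c/q^2$ for every rational $p/q$ (equivalently, irrational $x$ whose continued fraction partial quotients are bounded). $\mathbf{QI}$ is the set of quadratic irrationals in $[0,1]$: irrational roots of polynomials $ax^2+bx+c$ with $a,b,c\in\mathbb{Z}$, $a\ne0$. $T\colon[0,1]\to[0,1]$ is the Gauss map: $T(0)=0$ and $T(x)=\frac1x-\lfloor\frac1x\rfloor$ for $x\in(0,1]$. For positive integers $a_1,a_2,\dots$, the continuants $q_n=q_n(a_1,\dots,a_n)$ are defined by $q_{-1}=0$, $q_0=1$, $q_{n+1}=a_{n+1}q_n+q_{n-1}$ for $n\ge0$. *)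

(* Defs.v *)
From mathcomp Require Import all_boot all_order all_algebra.
From mathcomp Require Import all_classical all_reals all_analysis.

Set Implicit Arguments.
Unset Strict Implicit.
Unset Printing Implicit Defensive.

Import Order.TTheory GRing.Theory Num.Theory.
Import numFieldNormedType.Exports.

Local Open Scope classical_set_scope.
Local Open Scope ring_scope.

Section HausdorffMeasure.
Context {R : realType}.
Implicit Types (s d : R) (U A : set R) (F : (set R)^nat).

(* -oo for the empty set *)
Definition diam U : \bar R := ereal_sup [set `|x - y|%:E | x in U & y in U].

(* The empty set has weight 0 and, since x `^ 0 = 1, every nonempty set has
   weight 1 when s = 0, so that the 0-dimensional measure counts points. *)
Definition hausdorff_weight s U : \bar R :=
  if U == set0 then 0%E else (diam U `^ s)%E.

(* Finite covers are included: they can be padded with empty sets. *)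
Definition hausdorff_cover d A : set (set R)^nat :=
  [set F | A `<=` \bigcup_i F i /\ forall i, (diam (F i) <= d%:E)%E].

Definition hausdorff_content s d A : \bar R :=
  ereal_inf [set (\sum_(0 <= i <oo) hausdorff_weight s (F i))%E
            | F in hausdorff_cover d A].

(* The content is nonincreasing in d, so the supremum is the limit as d tends
   to 0 from the right. *)
Definition hausdorff_measure s A : \bar R :=
  ereal_sup [set hausdorff_content s d A | d in [set d | 0 < d]].

End HausdorffMeasure.

Section ContinuedFractions.
Context {R : realType}.

Definition gauss_map (x : R) : R :=
  if x == 0 then 0 else x^-1 - (Num.floor x^-1)%:~R.

(* The fold carries the pair (q_(n-1), q_n), starting from (q_(-1), q_0). *)
Definition continuant (a : seq nat) : nat :=
  (foldl (fun q ai => (q.2, ai * q.2 + q.1)%N) (0%N, 1%N) a).2.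

Definition badly_approximable : set R :=
  [set x | 0 < x <= 1 /\
    exists2 c : R, 0 < c &
      forall (p : int) (q : nat), (0 < q)%N ->
        `|x - p%:~R / q%:R| > c / q%:R ^+ 2].

Definition quadratic_irrational : set R :=
  [set x | [/\ 0 <= x <= 1, irrational x &
    exists a b c : int, a != 0 /\
      a%:~R * x ^+ 2 + b%:~R * x + c%:~R = 0]].

Definition W (psi : nat -> R) (B A : set R) : set R :=
  [set x | B x /\ exists2 alpha, A alpha &
    infinite_set [set n | `|iter n gauss_map x - alpha| < psi n]].

(* Real power with the convention 0 `^ 0 = 0, unlike the library's. *)
Definition powR0 (x s : R) : R := if x == 0 then 0 else x `^ s.

(* 'I_Q is {0, .., Q - 1}, hence the successor on the digits. *)
Definition psi_series (psi : nat -> R) (s : R) (Q : nat) : \bar R :=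
  (\sum_(1 <= n <oo)
     (\sum_(a : n.-tuple 'I_Q)
        powR0 (psi n) s
          / (continuant [seq i.+1 | i : 'I_Q <- a])%:R `^ (2 * s))%R%:E)%E.

End ContinuedFractions.

(* Main.v *)
(* Write T for the Gauss map and q(w) for the continuant of a word w of partial
   quotients.

   Convergence: if x is badly approximable, with constant c, comparing x with its
   convergents gives T^n x > c for all n, so all partial quotients are at most some
   Q.  Hence W is the union, over the countably many pairs (alpha, Q), of limsup
   sets covered at level n by Q^n pieces of diameter at most 2 psi(n) / q(w)^2, and
   the tails of the series bound the Hausdorff content.

   Divergence: let S_n be the sum of q(w)^(-2s) over the words of length n with
   digits at most M := Q + 1.  The additional digit makes S_n exceed the
   corresponding sum over digits at most Q by a factor growing exponentially in n,
   so psi(n)^s S_n is unbounded.  Along a sparse sequence of times n, one builds a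
   mass on words that distributes the digits up to n proportionally to q^(-2s) and
   then forces just enough digits 1 for T^n x to be psi(n)-close to the golden mean
   [0; 1, 1, 1, ...].  Quasi-multiplicativity of q shows that
   mass(w) = o(q(w)^(-2s)).  Branches with bounded digits that separate after the
   word w are at distance at least a constant times q(w)^(-2), so each set F of a
   cover only meets branches through a word of mass at most a small multiple of
   diam(F)^s.  A cover of finite weight therefore has total mass less than 1, and
   some branch escapes it. *)
Require Import Defs.
From mathcomp Require Import all_boot all_order all_algebra.
From mathcomp Require Import all_classical all_reals all_analysis.
From mathcomp Require Import zify ring lra.
Set Implicit Arguments.
Unset Strict Implicit.
Unset Printing Implicit Defensive.
Import Order.TTheory GRing.Theory Num.Theory.
Import numFieldNormedType.Exports.
Local Open Scope classical_set_scope.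
Local Open Scope ring_scope.

(** * Hausdorff content *)

Section HausdorffContent.
Context {R : realType}.
Implicit Types (s d : R) (U A : set R) (F : (set R)^nat).

Lemma diam_ge U x y : U x -> U y -> (`|x - y|%:E <= diam U)%E.
Proof. by move=> Ux Uy; apply: ereal_sup_ubound; exists x => //; exists y. Qed.

Lemma diam_le U (r : R) :
  (forall x y, U x -> U y -> `|x - y| <= r) -> (diam U <= r%:E)%E.
Proof.
by move=> Ur; apply: ge_ereal_sup => _ [x Ux [y Uy <-]]; rewrite lee_fin Ur.
Qed.

Lemma diam_ge0 U : U !=set0 -> (0 <= diam U)%E.
Proof. by move=> [x Ux]; have := diam_ge Ux Ux; rewrite subrr normr0. Qed.

Lemma hausdorff_weight0 s : hausdorff_weight s (@set0 R) = 0%E.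
Proof. by rewrite /hausdorff_weight eqxx. Qed.

Lemma hausdorff_weight_ge0 s U : (0 <= hausdorff_weight s U)%E.
Proof. by rewrite /hausdorff_weight; case: ifP => // _; exact: poweR_ge0. Qed.

Lemma diam0_le d : (diam (@set0 R) <= d%:E)%E.
Proof. exact: diam_le. Qed.

Lemma hausdorff_content_le s d A F : hausdorff_cover d A F ->
  (hausdorff_content s d A <= \sum_(0 <= i <oo) hausdorff_weight s (F i))%E.
Proof. by move=> AF; apply: ereal_inf_lbound; exists F. Qed.

Lemma hausdorff_content_ge0 s d A : (0 <= hausdorff_content s d A)%E.
Proof.
apply: le_ereal_inf_tmp => _ [F _ <-].
by apply: nneseries_ge0 => i _ _; exact: hausdorff_weight_ge0.
Qed.

Lemma hausdorff_contentS s d A B : A `<=` B ->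
  (hausdorff_content s d A <= hausdorff_content s d B)%E.
Proof.
move=> AB; apply: le_ereal_inf_tmp => _ [F [BF dF] <-].
by apply: hausdorff_content_le; split => //; exact: subset_trans BF.
Qed.

(* The content is the outer measure induced by the weight, set to +oo on the
   sets of diameter larger than d. *)
Lemma hausdorff_content_sigma_subadditive s d :
  sigma_subadditive (hausdorff_content s d).
Proof.
pose mu U := if `[< (diam U <= d%:E)%E >] then hausdorff_weight s U else +oo%E.
have mu_ge0 (U : set (g_sigma_algebraType [set: set R])) : (0 <= mu U)%E.
  by rewrite /mu; case: ifP => // _; exact: hausdorff_weight_ge0.
suff -> : hausdorff_content s d =
    @mu_ext _ (g_sigma_algebraType [set: set R]) R mu.
  exact: (@mu_ext_sigma_subadditive _ (g_sigma_algebraType [set: set R]) R mu mu_ge0).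
apply/funext => A; apply/eqP; rewrite eq_le; apply/andP; split.
  apply: le_ereal_inf_tmp => _ [F [_ AF] <-].
  have [dF|/existsNP[i dFi]] := pselect (forall i, (diam (F i) <= d%:E)%E).
    rewrite (eq_eseriesr (g := fun i => hausdorff_weight s (F i))).
      exact: hausdorff_content_le.
    by move=> i _; rewrite /mu asboolT.
  rewrite (eseries_pinfty (k := i)) ?leey//; last by rewrite /mu asboolF.
  by move=> n _; rewrite -ltNye (lt_le_trans _ (mu_ge0 _)).
apply: le_ereal_inf_tmp => _ [F [AF dF] <-].
apply: ereal_inf_lbound; exists F; first by split => // i; exact: sub_sigma_algebra.
by apply: eq_eseriesr => i _; rewrite /mu asboolT.
Qed.

Lemma hausdorff_content_bigcup_fin (T : finType) s d (F : T -> set R) :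
  (forall t, (diam (F t) <= d%:E)%E) ->
  (hausdorff_content s d (\bigcup_t F t) <= \sum_t hausdorff_weight s (F t))%E.
Proof.
move=> dF; pose E i := nth set0 [seq F t | t <- enum T] i.
have EF i : E i = set0 \/ exists t, E i = F t.
  have [ilt|ige] := ltnP i (size (enum T)); last first.
    by left; rewrite /E nth_default// size_map.
  have t0 : T by case: (enum T) ilt.
  by right; exists (nth t0 (enum T) i); rewrite /E (nth_map t0).
have cE : hausdorff_cover d (\bigcup_t F t) E.
  split=> [x [t _ Ftx]|i].
    exists (index t (enum T)) => //; rewrite /E (nth_map t) ?index_mem ?mem_enum//.
    by rewrite nth_index// mem_enum.
  by case: (EF i) => [->|[t ->]]; [exact: diam0_le|exact: dF].
apply: (le_trans (hausdorff_content_le s cE)).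
rewrite (nneseries_split 0 #|T|) => [|i _]; last exact: hausdorff_weight_ge0.
rewrite [X in (_ + X)%E]eseries0 => [|i]; last first.
  rewrite add0n => Ti _; rewrite /E nth_default ?hausdorff_weight0//.
  by rewrite size_map -cardE.
rewrite adde0 add0n -[in leRHS]big_enum/= cardE.
rewrite -(size_map F) -(big_map F xpredT (hausdorff_weight s)).
by rewrite [leRHS](big_nth set0).
Qed.

Lemma hausdorff_measure_eq0 s A :
  (forall d, 0 < d -> hausdorff_content s d A = 0%E) ->
  hausdorff_measure s A = 0%E.
Proof.
move=> A0; rewrite /hausdorff_measure.
rewrite (_ : [set _ | _ in _] = [set 0%E]) ?ereal_sup1//.
apply/seteqP; split=> [_ [d d0 <-]|_ ->]; first exact: A0.
by exists 1; [exact: ltr01|apply: A0; exact: ltr01].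
Qed.

Lemma hausdorff_measure_eqy s A :
  (forall L : R, 0 < L -> exists2 d, 0 < d & (L%:E <= hausdorff_content s d A)%E) ->
  hausdorff_measure s A = +oo%E.
Proof.
move=> AL; apply/eqyP => L L0; have [d d0 Ld] := AL _ L0.
by apply: le_trans Ld _; apply: ereal_sup_ubound; exists d.
Qed.

Lemma hausdorff_content_bigcup0 (T : countType) s d (A : T -> set R) :
  (forall t, hausdorff_content s d (A t) = 0%E) ->
  hausdorff_content s d (\bigcup_t A t) = 0%E.
Proof.
move=> A0; pose B n := if unpickle n is Some t then A t else set0.
apply/eqP; rewrite eq_le hausdorff_content_ge0 andbT.
apply: (@le_trans _ _ (hausdorff_content s d (\bigcup_n B n))).
  apply: hausdorff_contentS => x [t _ Atx]; exists (pickle t) => //.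
  by rewrite /B pickleK.
apply: (le_trans (hausdorff_content_sigma_subadditive s d B)).
rewrite eseries0// => n _ _; rewrite /B; case: unpickle => [t|]; first exact: A0.
apply/eqP; rewrite eq_le hausdorff_content_ge0 andbT.
have c0 : hausdorff_cover d (@set0 R) (fun=> set0).
  by split => // i; exact: diam0_le.
apply: (le_trans (hausdorff_content_le s c0)).
by rewrite eseries0// => i _ _; rewrite hausdorff_weight0.
Qed.

End HausdorffContent.

(** * Continued fractions *)

(* A word lists the partial quotients from the last one to the first one, so
   that appending a partial quotient is a cons. *)
Definition pair_step (a : nat) (q : nat * nat) : nat * nat :=
  (q.2, a * q.2 + q.1)%N.

(** These hold consecutive denominators [(q_(n-1), q_n)] and numerators [(p_(n-1), p_n)] of the
    convergents; the seeds are the pairs at [n = 0]. *)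
Definition dens (w : seq nat) : nat * nat := foldr pair_step (0, 1)%N w.
Definition nums (w : seq nat) : nat * nat := foldr pair_step (1, 0)%N w.
Definition den (w : seq nat) : nat := (dens w).2.

Notation digits Q := (all (fun a => 0 < a <= Q)%N).

Lemma denE (a : seq nat) : den (rev a) = continuant a.
Proof. by rewrite /den /dens /continuant -[in RHS](revK a) foldl_rev. Qed.

Lemma dens_bounds Q w : digits Q w ->
  [/\ (dens w).1 <= den w, 0 < den w, size w <= den w &
      den w <= Q.+1 ^ size w]%N.
Proof.
(* A nonempty word has a positive previous denominator, so each further digit raises [den] by at
   least 1; this gives [size w <= den w]. *)
suff H : digits Q w -> [/\ (dens w).1 <= den w, 0 < den w, size w <= den w,
    (0 < size w)%N ==> (0 < (dens w).1)%N & den w <= Q.+1 ^ size w]%N.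
  by move=> /H[].
elim: w => [|a w IH]//= /andP[/andP[a0 aQ] /IH[h1 h2 h3 h4 h5]].
rewrite /den/= -/(den w); split.
- nia.
- nia.
- by case: (size w) h3 h4 => [|k] h3 /= h4; nia.
- exact: h2.
- by rewrite expnS; nia.
Qed.

(** * Inverse branches of the Gauss map *)

Section Cylinders.
Context {R : realType}.
Implicit Types (x t : R) (w : seq nat).

(** The inverse branch of the [size w]-th iterate of the Gauss map; as words are reversed, the head
    of [w] is the innermost digit. *)
Fixpoint cyl w t : R := if w is a :: w' then cyl w' (a%:R + t)^-1 else t.

Lemma cyl_rcons w a t : cyl (rcons w a) t = (a%:R + cyl w t)^-1.
Proof. by elim: w t => //= b w IH t; rewrite IH. Qed.

Lemma digit_inv_bounds Q a t : (0 < a <= Q)%N -> 0 <= t <= 1 ->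
  (Q.+1%:R)^-1 <= (a%:R + t)^-1 <= 1 /\ 0 < a%:R + t.
Proof.
move=> /andP[a0 aQ] /andP[t0 t1].
have a1 : 1 <= a%:R :> R by rewrite ler1n.
have aQ' : a%:R <= Q%:R :> R by rewrite ler_nat.
have at0 : 0 < a%:R + t by lra.
split=> //; rewrite invf_le1//; apply/andP; split; last lra.
by rewrite lef_pV2 ?posrE// -natr1; lra.
Qed.

Lemma digit_inv01 Q a t : (0 < a <= Q)%N -> 0 <= t <= 1 ->
  0 <= (a%:R + t)^-1 <= 1.
Proof.
move=> aQ t01; have [/andP[h1 ->] _] := digit_inv_bounds aQ t01.
by rewrite (le_trans _ h1)// invr_ge0.
Qed.

Lemma dens_bounds_real Q w t : digits Q w -> 0 <= t <= 1 ->
  [/\ 1 <= (den w)%:R :> R, (den w)%:R <= (den w)%:R + (dens w).1%:R * t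
    & (den w)%:R + (dens w).1%:R * t <= 2 * (den w)%:R].
Proof.
move=> wQ /andP[t0 t1]; have [h1 h2 _ _] := dens_bounds wQ.
have h3 : 1 <= (den w)%:R :> R by rewrite ler1n.
have h4 : (dens w).1%:R <= (den w)%:R :> R by rewrite ler_nat.
have h5 : 0 <= (dens w).1%:R :> R by [].
by split => //; nra.
Qed.

Lemma cylE Q w t : digits Q w -> 0 <= t <= 1 ->
  cyl w t = ((nums w).2%:R + (nums w).1%:R * t) /
            ((den w)%:R + (dens w).1%:R * t).
Proof.
elim: w t => [|a w IH] t /=; first by rewrite /den /= add0r mul1r mul0r addr0 divr1.
move=> /andP[aQ wQ] t01; have [_ at0] := digit_inv_bounds aQ t01.
have i01 := digit_inv01 aQ t01; rewrite (IH _ wQ i01).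
have [d1 d2 _] := dens_bounds_real wQ i01.
rewrite /den/= -/(den w) !natrD !natrM.
have e1 : (den w)%:R + (dens w).1%:R / (a%:R + t) != 0 by apply/eqP; lra.
have e2 : a%:R * (den w)%:R + (dens w).1%:R + (den w)%:R * t != 0.
  have q1 : 0 <= (dens w).1%:R :> R by [].
  have : 0 < (a%:R + t) * (den w)%:R by apply: mulr_gt0 => //; lra.
  by move=> h; apply/eqP; lra.
have e3 : a%:R + t != 0 by apply/eqP; lra.
by field; rewrite e2 e3.
Qed.

(** Each [pair_step] has determinant -1, so every digit flips the sign. *)
Lemma det_nums_dens w :
  (nums w).2%:Z * (dens w).1%:Z - (nums w).1%:Z * (den w)%:Z =
  (-1) ^+ (size w).+1.
Proof.
elim: w => [|a w IH]; first by [].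
rewrite /den/= -/(den w) exprS -IH !PoszD !PoszM; ring.
Qed.

(** Subtracting two values of the Möbius form [cylE] leaves the determinant in the numerator; its
    sign records the orientation of the branch. *)
Lemma cylB Q w t t' : digits Q w -> 0 <= t <= 1 -> 0 <= t' <= 1 ->
  cyl w t - cyl w t' = (-1) ^+ size w * (t - t') /
    (((den w)%:R + (dens w).1%:R * t) * ((den w)%:R + (dens w).1%:R * t')).
Proof.
move=> wQ t01 t01'; rewrite !(cylE wQ)//.
have [d1 d2 _] := dens_bounds_real wQ t01.
have [_ d2' _] := dens_bounds_real wQ t01'.
have e1 : (den w)%:R + (dens w).1%:R * t != 0 by apply/eqP; lra.
have e2 : (den w)%:R + (dens w).1%:R * t' != 0 by apply/eqP; lra.
have := congr1 (fun z : int => z%:~R : R) (det_nums_dens w).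
rewrite intrB !intrM -!pmulrn rmorphXn/= rmorphN1 exprS mulN1r => dt.
have -> : (-1) ^+ size w =
    (nums w).1%:R * (den w)%:R - (nums w).2%:R * (dens w).1%:R :> R.
  by rewrite -opprB dt opprK.
by field; rewrite e1 e2.
Qed.

(** Both factors of the denominator in [cylB] lie between [den w] and [2 * den w]. *)
Lemma cyl_dist Q w t t' : digits Q w -> 0 <= t <= 1 -> 0 <= t' <= 1 ->
  `|t - t'| / (4 * (den w)%:R ^+ 2) <= `|cyl w t - cyl w t'| <=
  `|t - t'| / (den w)%:R ^+ 2.
Proof.
move=> wQ t01 t01'; rewrite (cylB wQ)//.
have [d1 d2 d3] := dens_bounds_real wQ t01.
have [_ d2' d3'] := dens_bounds_real wQ t01'.
set A := (_ + _ * t); set B := (_ + _ * t').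
rewrite normrM normrM normrX normrN1 expr1n mul1r normfV.
have AB0 : 0 < A * B by apply: mulr_gt0; rewrite /A /B; lra.
rewrite (gtr0_norm AB0); apply/andP; split; apply: ler_wpM2l => //.
  rewrite lef_pV2 ?posrE//; first by rewrite /A /B in AB0 *; nra.
  by nra.
by rewrite lef_pV2 ?posrE//; [rewrite /A /B; nra|nra].
Qed.

(** By [cylB] the branch is monotone, increasing or decreasing with the parity of the length, hence
    the minimum and maximum. *)
Lemma cyl_between Q w t : digits Q w -> 0 <= t <= 1 ->
  Num.min (cyl w 0) (cyl w 1) <= cyl w t <= Num.max (cyl w 0) (cyl w 1).
Proof.
move=> wQ t01; have z01 : 0 <= (0 : R) <= 1 by rewrite lexx ler01.
have o01 : 0 <= (1 : R) <= 1 by rewrite lexx ler01.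
have := cylB wQ t01 z01; have := cylB wQ o01 t01.
have [d1 d2 _] := dens_bounds_real wQ t01.
have [_ d3 _] := dens_bounds_real wQ z01.
have [_ d4 _] := dens_bounds_real wQ o01.
move: d2 d3 d4; set A := (_ + _ * t); set B := (_ + _ * 0); set C := (_ + _ * 1).
move=> d2 d3 d4; move/andP: t01 => [t0 t1].
have k1 : 0 <= (1 - t) / (C * A) by apply: divr_ge0; [lra|apply: mulr_ge0; lra].
have k2 : 0 <= (t - 0) / (A * B) by apply: divr_ge0; [lra|apply: mulr_ge0; lra].
rewrite -signr_odd -!mulrA.
case: odd => /=; rewrite ?expr1 ?expr0 ?mulN1r ?mul1r => e1 e2.
  by rewrite ge_min le_max; apply/andP; split; apply/orP; [right|left]; lra.
by rewrite ge_min le_max; apply/andP; split; apply/orP; [left|right]; lra.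
Qed.

End Cylinders.

(** * Infinite continued fractions with bounded digits *)

Section InfiniteFractions.
Context {R : realType}.
Implicit Types (a : nat -> nat) (x t : R).

Definition prefix_word a n : seq nat := rev (mkseq a n).

Lemma prefix_wordS a n : prefix_word a n.+1 = a n :: prefix_word a n.
Proof. by rewrite /prefix_word mkseqS rev_rcons. Qed.

Lemma size_prefix_word a n : size (prefix_word a n) = n.
Proof. by rewrite size_rev size_mkseq. Qed.

Definition shift (k : nat) a : nat -> nat := fun n => a (k + n)%N.

Lemma prefix_word_shift1 a n :
  prefix_word a n.+1 = rcons (prefix_word (shift 1 a) n) (a 0%N).
Proof.
rewrite /prefix_word -rev_cons; congr rev; rewrite /mkseq /= (iotaDl 1 0) -map_comp.
by congr cons; apply: eq_map.
Qed.

Lemma digits_prefix_word Q a n : (forall i, (0 < a i <= Q)%N) ->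
  digits Q (prefix_word a n).
Proof. by move=> aQ; elim: n => // n IH; rewrite prefix_wordS /= aQ. Qed.

Lemma eq_prefix_word a b n : (forall i, (i < n)%N -> a i = b i) ->
  prefix_word a n = prefix_word b n.
Proof.
by move=> ab; congr rev; apply/eq_in_map => i; rewrite mem_iota => /ab.
Qed.

Definition cyl_lo w : R := Num.min (cyl w 0) (cyl w 1).
Definition cyl_hi w : R := Num.max (cyl w 0) (cyl w 1).

(** A supremum of lower endpoints needs no convergence argument; for bounded digits it is the only
    point common to all the nested cylinders. *)
Definition cf_value a : R := sup [set cyl_lo (prefix_word a n) | n in setT].

Section BoundedDigits.
Context (Q : nat).

Let zero01 : 0 <= (0 : R) <= 1. Proof. by rewrite lexx ler01. Qed.
Let one01 : 0 <= (1 : R) <= 1. Proof. by rewrite lexx ler01. Qed.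

Lemma cyl_lo_le_hi w : cyl_lo w <= cyl_hi w.
Proof. by rewrite ge_min !le_max lexx. Qed.

Lemma cyl_nested a m n : (forall i, (0 < a i <= Q)%N) -> (m <= n)%N ->
  cyl_lo (prefix_word a m) <= cyl_lo (prefix_word a n) /\
  cyl_hi (prefix_word a n) <= cyl_hi (prefix_word a m).
Proof.
move=> aQ /subnKC <-; elim: (n - m)%N => [|k [IH1 IH2]]; first by rewrite addn0.
rewrite addnS prefix_wordS; set w := prefix_word a (m + k) in IH1 IH2 *.
have wQ : digits Q w by exact: digits_prefix_word.
have b0 := cyl_between wQ (digit_inv01 (aQ (m + k)%N) zero01).
have b1 := cyl_between wQ (digit_inv01 (aQ (m + k)%N) one01).
move/andP: b0 => [b0 b0']; move/andP: b1 => [b1 b1'].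
split; [apply: le_trans IH1 _|apply: le_trans IH2].
  by have /andP := conj b0 b1; rewrite -le_min.
by have /andP := conj b0' b1'; rewrite -ge_max.
Qed.

Lemma cf_value_between a n : (forall i, (0 < a i <= Q)%N) ->
  cyl_lo (prefix_word a n) <= cf_value a <= cyl_hi (prefix_word a n).
Proof.
move=> aQ; set E := [set cyl_lo (prefix_word a n) | n in setT].
have ubE k : ubound E (cyl_hi (prefix_word a k)).
  move=> _ [m _ <-]; have [h1 _] := cyl_nested aQ (leq_maxl m k).
  have [_ h2] := cyl_nested aQ (leq_maxr m k).
  by apply: le_trans h1 (le_trans (cyl_lo_le_hi _) h2).
apply/andP; split; last by apply: ge_sup;
  [exists (cyl_lo (prefix_word a 0)), 0%N|exact: ubE].
by apply: ub_le_sup; [exists (cyl_hi (prefix_word a 0)); exact: ubE|exists n].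
Qed.

Lemma cyl_width w : digits Q w -> cyl_hi w - cyl_lo w <= (den w)%:R ^-2.
Proof.
move=> wQ; have /andP[_] := cyl_dist wQ zero01 one01.
rewrite sub0r normrN1 mul1r; apply: le_trans.
by rewrite /cyl_hi /cyl_lo maxr_absE minr_absE; lra.
Qed.

Lemma cf_value_unique a x : (forall i, (0 < a i <= Q)%N) ->
  (forall n, cyl_lo (prefix_word a n) <= x <= cyl_hi (prefix_word a n)) ->
  x = cf_value a.
Proof.
move=> aQ xa; apply/eqP; rewrite -subr_eq0 -normr_le0; apply/ler_addgt0Pl => e e0.
rewrite addr0; pose n := (Num.truncn e^-1).+1.
have ne : e^-1 < n%:R by exact: truncnS_gt.
have wQ := digits_prefix_word n aQ.
have := cyl_width wQ; have [_ d0 dn _] := dens_bounds wQ.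
rewrite size_prefix_word in dn; move: (xa n) (cf_value_between n aQ).
set w := prefix_word a n in d0 dn *; move=> /andP[x1 x2] /andP[y1 y2] ww.
have : (den w)%:R ^- 2 <= e.
  rewrite invf_ple ?posrE ?exprn_gt0 ?ltr0n//.
  have : n%:R <= (den w)%:R :> R by rewrite ler_nat.
  have : 1 <= (den w)%:R :> R by rewrite ler1n.
  by nra.
by move=> h; rewrite ler_norml; lra.
Qed.

Lemma cf_value01 a : (forall i, (0 < a i <= Q)%N) -> 0 <= cf_value a <= 1.
Proof.
move=> aQ; have := cf_value_between 0 aQ.
by rewrite /cyl_lo /cyl_hi /prefix_word /= (min_idPl _) ?ler01// (max_idPr _) ?ler01.
Qed.

Lemma shift_digits k a : (forall i, (0 < a i <= Q)%N) ->
  forall i, (0 < shift k a i <= Q)%N.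
Proof. by move=> aQ i; exact: aQ. Qed.

(** By uniqueness it suffices that the right-hand side lies in every cylinder of [a]. The decreasing
    map [y |-> 1 / (a 0 + y)] carries the cylinders of the shifted sequence to those of [a]. *)
Lemma cf_value_shift1 a : (forall i, (0 < a i <= Q)%N) ->
  cf_value a = ((a 0)%:R + cf_value (shift 1 a))^-1.
Proof.
move=> aQ; apply/esym/cf_value_unique => // n.
have aQ1 := shift_digits 1 aQ; have y01 := cf_value01 aQ1.
case: n => [|n].
  rewrite /cyl_lo /cyl_hi /prefix_word /= (min_idPl _) ?ler01// (max_idPr _) ?ler01//.
  exact: digit_inv01 (aQ 0%N) y01.
have := cf_value_between n aQ1.
rewrite prefix_word_shift1 /cyl_lo /cyl_hi !cyl_rcons.
set w := prefix_word (shift 1 a) n; have wQ : digits Q w by exact: digits_prefix_word.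
set y := cf_value _ in y01 *.
have a1 : 1 <= (a 0%N)%:R :> R by rewrite ler1n; case/andP: (aQ 0%N).
have cyl_ge0 t : 0 <= t <= 1 -> 0 <= cyl w t.
  move=> t01; rewrite (cylE wQ t01); case/andP: t01 => t0 t1.
  by apply: divr_ge0; apply: addr_ge0 => //; apply: mulr_ge0.
have c0 := cyl_ge0 _ zero01; have c1 := cyl_ge0 _ one01.
move: c0 c1 y01; set A := cyl w 0; set B := cyl w 1 => A0 B0 /andP[y0 y1].
have inv_le (u v : R) : 0 <= u -> u <= v -> ((a 0%N)%:R + v)^-1 <= ((a 0%N)%:R + u)^-1.
  by move=> u0 uv; rewrite lef_pV2 ?posrE; lra.
rewrite !ge_min !le_max => /andP[/orP h1 /orP h2]; apply/andP; split; apply/orP.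
  by case: h2 => h; [left|right]; apply: inv_le.
by case: h1 => h; [left|right]; apply: inv_le.
Qed.

Lemma cf_value_bounds a : (forall i, (0 < a i <= Q)%N) ->
  Q.+1%:R^-1 <= cf_value a < 1.
Proof.
move=> aQ; have aQ1 := shift_digits 1 aQ.
have lb b : (forall i, (0 < b i <= Q)%N) -> Q.+1%:R^-1 <= cf_value b.
  move=> bQ; rewrite (cf_value_shift1 bQ).
  by have [/andP[]] := digit_inv_bounds (bQ 0%N) (cf_value01 (shift_digits 1 bQ)).
rewrite lb//= (cf_value_shift1 aQ); have := lb _ aQ1; set y := cf_value _ => y0.
have y1 : 0 < y by apply: lt_le_trans y0; rewrite invr_gt0 ltr0n.
have a1 : 1 <= (a 0%N)%:R :> R by rewrite ler1n; case/andP: (aQ 0%N).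
by rewrite invf_lt1; lra.
Qed.

Lemma shiftS k a : shift k.+1 a = shift 1 (shift k a).
Proof. by apply/funext => n; rewrite /shift addnA addn1. Qed.

Lemma cf_value_cyl a n : (forall i, (0 < a i <= Q)%N) ->
  cf_value a = cyl (prefix_word a n) (cf_value (shift n a)).
Proof.
move=> aQ; elim: n => [|n IH]; first by [].
rewrite prefix_wordS /= IH (cf_value_shift1 (shift_digits n aQ)) -shiftS.
by rewrite /shift addn0.
Qed.

Lemma gauss_map_cf_value a : (forall i, (0 < a i <= Q)%N) ->
  gauss_map (cf_value a) = cf_value (shift 1 a).
Proof.
move=> aQ; rewrite /gauss_map; have /andP[lb _] := cf_value_bounds aQ.
have a0 : 0 < cf_value a by apply: lt_le_trans lb; rewrite invr_gt0 ltr0n.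
rewrite gt_eqF// (cf_value_shift1 aQ) invrK.
have /andP[lb1 ub1] := cf_value_bounds (shift_digits 1 aQ).
have b0 : 0 <= cf_value (shift 1 a) by apply: le_trans lb1; rewrite invr_ge0.
rewrite (@floor_def _ _ (a 0%N)%:Z); first by rewrite -pmulrn addrAC subrr add0r.
by rewrite intrD -pmulrn lerDl b0 /= ltrD2l.
Qed.

Lemma iter_gauss_map_cf_value a n : (forall i, (0 < a i <= Q)%N) ->
  iter n gauss_map (cf_value a) = cf_value (shift n a).
Proof.
move=> aQ; elim: n => [|n IH] //=.
by rewrite IH (gauss_map_cf_value (shift_digits n aQ)) -shiftS.
Qed.

(** The difference of the denominators is at least [1 + z - y], hence at least [1 / K], and each
    denominator is at most [K]. *)
Lemma inv_digit_gap (K A B y z : R) : 1 <= A -> A + 1 <= B -> B + 1 <= K ->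
  K^-1 <= y < 1 -> K^-1 <= z < 1 -> K ^- 3 <= `|(A + y)^-1 - (B + z)^-1|.
Proof.
move=> A1 AB BK; have K0 : 0 < K by lra.
have := K0; rewrite -invr_gt0; move: (K^-1) (mulfV (lt0r_neq0 K0)) => k kK k0.
move=> /andP[y0 y1] /andP[z0 z1].
have ay : A + y != 0 by rewrite gt_eqF//; lra.
have bz : B + z != 0 by rewrite gt_eqF//; lra.
have -> : (A + y)^-1 - (B + z)^-1 = (B + z - (A + y)) / ((A + y) * (B + z)).
  by field; rewrite ay bz.
apply: le_trans (ler_norm _).
have -> : K ^- 3 = k / (K * K).
  apply: (mulfI (lt0r_neq0 K0)); rewrite mulrA kK; field.
  by rewrite lt0r_neq0.
apply: ler_pM; [by rewrite ltW|by rewrite invr_ge0 mulr_ge0 ?ltW|lra|].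
by rewrite lef_pV2 ?posrE; [apply: ler_pM; lra|exact: mulr_gt0|apply: mulr_gt0; lra].
Qed.

(** The tails after the common prefix differ by at least [(Q + 1) ^ -3] ([inv_digit_gap]), and the
    common inverse branch contracts by at most [4 * den ^ 2] ([cyl_dist]). *)
Lemma cf_value_separation a b n : (forall i, (0 < a i <= Q)%N) ->
  (forall i, (0 < b i <= Q)%N) -> (forall i, (i < n)%N -> a i = b i) ->
  a n != b n ->
  (4 * Q.+1%:R ^+ 3 * (den (prefix_word a n))%:R ^+ 2)^-1 <=
  `|cf_value a - cf_value b|.
Proof.
move=> aQ bQ ab abn; wlog ltab : a b aQ bQ ab abn / (a n < b n)%N.
  move=> H; case: (ltngtP (a n) (b n)) => [lt|lt|e]; last by rewrite e eqxx in abn.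
    exact: H.
  rewrite distrC (eq_prefix_word ab); apply: H => //; last by rewrite eq_sym.
  by move=> i /ab.
have aQn := shift_digits n aQ; have bQn := shift_digits n bQ.
have wQ := digits_prefix_word n aQ.
rewrite (cf_value_cyl n aQ) (cf_value_cyl n bQ) -(eq_prefix_word ab).
have /andP[h _] := cyl_dist wQ (cf_value01 aQn) (cf_value01 bQn); apply: le_trans h.
rewrite -mulrA mulrCA invfM ler_wpM2r ?invr_ge0 ?mulr_ge0//.
rewrite (cf_value_shift1 aQn) (cf_value_shift1 bQn).
rewrite [shift n a 0]/shift [shift n b 0]/shift !addn0.
apply: inv_digit_gap; rewrite ?ler1n ?natr1 ?ler_nat ?ltnS//.
- by case/andP: (aQ n).
- by case/andP: (bQ n).
- exact/cf_value_bounds/shift_digits.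
- exact/cf_value_bounds/shift_digits.
Qed.

End BoundedDigits.
End InfiniteFractions.

(** * Sums of continuants *)

(* [ext_sum s M j u v] sums [den ^ (- 2 s)] over all extensions by [j] partial
   quotients, each at most [M], of a word whose last two denominators are
   [(u, v)]. *)
Section ExtensionSums.
Context {R : realType} (s : R).
Hypothesis s0 : 0 <= s.

Definition den_weight (v : nat) : R := (v%:R `^ (2 * s))^-1.

Fixpoint ext_sum (M j u v : nat) : R :=
  if j is j'.+1 then \sum_(i < M) ext_sum M j' v (i.+1 * v + u)%N
  else den_weight v.

Lemma den_weight_gt0 v : (0 < v)%N -> 0 < den_weight v.
Proof. by move=> v0; rewrite /den_weight invr_gt0 powR_gt0// ltr0n. Qed.

Lemma den_weight1 : den_weight 1 = 1.
Proof. by rewrite /den_weight powR1 invr1. Qed.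

Lemma den_weightM c v : den_weight (c * v) = den_weight c * den_weight v.
Proof. by rewrite /den_weight natrM powRM// invfM. Qed.

Lemma den_weight_le v v' : (0 < v <= v')%N -> den_weight v' <= den_weight v.
Proof.
move=> /andP[v0 vv']; rewrite /den_weight lef_pV2 ?posrE ?powR_gt0 ?ltr0n//; last lia.
by apply: ge0_ler_powR; rewrite ?nnegrE ?mulr_ge0// ler_nat.
Qed.

Lemma den_weight_le1 v : (0 < v)%N -> den_weight v <= 1.
Proof. by move=> v0; rewrite -den_weight1; apply: den_weight_le. Qed.

Lemma ext_sum_gt0 M j u v : (0 < M)%N -> (0 < v)%N -> 0 < ext_sum M j u v.
Proof.
move=> M0; elim: j u v => [|j IH] u v v0 /=; first exact: den_weight_gt0.
case: M M0 IH => // M _ IH; rewrite big_ord_recl ltr_wpDr ?IH//; last lia.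
by apply: sumr_ge0 => i _; apply/ltW/IH; lia.
Qed.

Lemma ext_sum_ge0 M j u v : (0 < v)%N -> 0 <= ext_sum M j u v.
Proof.
elim: j u v => [|j IH] u v v0 /=; first exact/ltW/den_weight_gt0.
by apply: sumr_ge0 => i _; apply: IH; lia.
Qed.

Lemma ext_sum_le M j u v u' v' : (0 < v)%N -> (u <= u')%N -> (v <= v')%N ->
  ext_sum M j u' v' <= ext_sum M j u v.
Proof.
elim: j u v u' v' => [|j IH] u v u' v' v0 uu' vv' /=.
  by apply: den_weight_le; rewrite v0.
by apply: ler_sum => i _; apply: IH; nia.
Qed.

(** The recursion is linear in [(u, v)] and the weight is multiplicative. Rescaling then turns
    comparisons of sums into comparisons of pairs via [ext_sum_le]. *)
Lemma ext_sumM M j c u v :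
  ext_sum M j (c * u) (c * v) = den_weight c * ext_sum M j u v.
Proof.
elim: j u v => [|j IH] u v /=; first exact: den_weightM.
rewrite mulr_sumr; apply: eq_bigr => i _; rewrite -IH; congr ext_sum; lia.
Qed.

Lemma ext_sum_le_root M j u v : (0 < v)%N ->
  ext_sum M j u v <= den_weight v * ext_sum M j 0 1.
Proof. by move=> v0; rewrite -ext_sumM; apply: ext_sum_le; lia. Qed.

Lemma ext_sum_ge_root M j u v : (0 < v)%N -> (u <= v)%N ->
  den_weight 2 * (den_weight v * ext_sum M j 0 1) <= ext_sum M j u v.
Proof.
move=> v0 uv; have /(le_trans _) : ext_sum M j v v <= ext_sum M j u v.
  exact: ext_sum_le.
apply; have -> : ext_sum M j v v = den_weight v * ext_sum M j 1 1.
  by rewrite -ext_sumM !muln1.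
rewrite mulrCA ler_pM2l ?den_weight_gt0//.
(* The doubled root pair [(0, 2)] does not dominate [(1, 1)], but after one digit [i + 1] the pair
   [(2, 2 i + 2)] dominates [(1, i + 2)]. *)
case: j => [|j] /=.
  by rewrite den_weight1 mulr1; apply: den_weight_le1.
rewrite mulr_sumr; apply: ler_sum => i _; rewrite -ext_sumM.
by apply: ext_sum_le; lia.
Qed.

(** This and [ext_sum_supermul] are the quasi-multiplicativity of continuants: after the first [i]
    digits, the sum over the rest is compared with the sum from the root. *)
Lemma ext_sum_submul M i j u v : (0 < v)%N ->
  ext_sum M (i + j) u v <= ext_sum M i u v * ext_sum M j 0 1.
Proof.
elim: i u v => [|i IH] u v v0 /=; first exact: ext_sum_le_root.
by rewrite mulr_suml; apply: ler_sum => k _; apply: IH; lia.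
Qed.

Lemma ext_sum_supermul M i j u v : (0 < v)%N -> (u <= v)%N ->
  den_weight 2 * (ext_sum M i u v * ext_sum M j 0 1) <= ext_sum M (i + j) u v.
Proof.
elim: i u v => [|i IH] u v v0 uv /=; first exact: ext_sum_ge_root.
by rewrite mulr_suml mulr_sumr; apply: ler_sum => k _; apply: IH; lia.
Qed.

Definition ext_gain (Q : nat) : R := 1 + den_weight Q.+2 / Q%:R.

Lemma ext_gain_gt1 Q : (0 < Q)%N -> 1 < ext_gain Q.
Proof. by move=> Q0; rewrite ltrDl divr_gt0 ?den_weight_gt0 ?ltr0n. Qed.

(** Taking the digit [Q + 1] instead of a smaller one multiplies denominators by at most [Q + 2].
    Its term is therefore at least [den_weight Q.+2] times each of the other [Q] terms, which gives
    the gain at every position. *)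
Lemma ext_sum_gain Q j u v : (0 < Q)%N -> (0 < v)%N -> (u <= v)%N ->
  ext_gain Q ^+ j * ext_sum Q j u v <= ext_sum Q.+1 j u v.
Proof.
move=> Q0; have g0 : 0 < ext_gain Q by apply: lt_trans (ext_gain_gt1 Q0).
elim: j u v => [|j IH] u v v0 uv; first by rewrite expr0 mul1r.
rewrite [in leRHS]/= big_ord_recr/=.
apply: (@le_trans _ _ (ext_gain Q ^+ j * (\sum_(i < Q) ext_sum Q j v (i.+1 * v + u) +
   ext_sum Q j v (Q.+1 * v + u)))); last first.
  rewrite mulrDr mulr_sumr lerD//; last by apply: IH; lia.
  by apply: ler_sum => i _; apply: IH; lia.
rewrite exprSr -mulrA ler_pM2l ?exprn_gt0// mulrDl mul1r lerD2l.
rewrite mulrAC ler_pdivrMr ?ltr0n// mulr_sumr.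
set x := ext_sum _ _ _ (Q.+1 * v + u).
have -> : x * Q%:R = \sum_(i < Q) x by rewrite sumr_const card_ord mulr_natr.
apply: ler_sum => i _.
by rewrite -ext_sumM; apply: ext_sum_le; nia.
Qed.

End ExtensionSums.

(** * The convergence case *)

Lemma infinite_set_natP (A : set nat) :
  infinite_set A <-> forall N, exists2 n, (N <= n)%N & A n.
Proof.
split=> [Ainf N|AN Afin].
  apply: contrapT => AN; apply: Ainf; apply: (@sub_finite_set _ _ `I_N) => //.
  move=> n An /=; rewrite ltnNge; apply/negP => Nn; apply: AN.
  by exists n.
have /finite_seqP[r Ar] := Afin.
have [n rn] := AN (\max_(i <- r) i).+1.
by rewrite Ar /= => nr; move: rn; rewrite ltnNge leq_bigmax_seq.
Qed.

(** * Digits of badly approximable numbers; countability of quadratic irrationals *)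

Section BadlyApproximableCylinders.
Context {R : realType}.
Implicit Types (x y : R).

Lemma gauss_map_digit y : 0 < y <= 1 ->
  exists a : nat, [/\ (0 < a)%N, a%:R <= y^-1, 0 <= gauss_map y < 1
    & y = (a%:R + gauss_map y)^-1].
Proof.
move=> /andP[y0 y1]; rewrite /gauss_map gt_eqF//.
have : 1 <= y^-1 by rewrite invf_ge1.
rewrite -floor_gt0; have := floor_itv y^-1.
case: (Num.floor _) => // a /andP[a1 a2] a0; exists a; rewrite -pmulrn in a1 *.
move: a2; rewrite intrD -pmulrn => a2.
split=> //; last by rewrite addrCA subrr addr0 invrK.
by rewrite subr_ge0 a1/= ltrBlDr addrC.
Qed.

Lemma badly_approximable_cyl x : badly_approximable x ->
  exists Q, forall n, exists w, [/\ size w = n, digits Q.+1 w,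
    0 <= iter n gauss_map x <= 1 & x = cyl w (iter n gauss_map x)].
Proof.
case=> /andP[x0 x1] [c c0 xc]; exists (Num.truncn c^-1) => n.
(* The induction carries the lower bound [c] on the iterate: it keeps the iterate nonzero and bounds
   the next digit by [1 / c]. *)
suff [w [wn wQ /andP[cT T1] xw]] : exists w, [/\ size w = n,
    digits (Num.truncn c^-1).+1 w, c < iter n gauss_map x <= 1
    & x = cyl w (iter n gauss_map x)].
  by exists w; split=> //; rewrite T1 ltW// (lt_trans c0).
elim: n => [|n [w [wn wQ /andP[cT T1] xw]]].
  exists [::]; split=> //=; rewrite x1 andbT.
  by have := xc 0 1%N isT; rewrite mul0r subr0 expr1n divr1 gtr0_norm.
have T0 := lt_trans c0 cT.
have [|a [a0 aT T'01 Ta]] := @gauss_map_digit (iter n gauss_map x).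
  by rewrite T0.
rewrite -iterS in T'01 Ta; move: T'01; set y := iter n.+1 _ _ in Ta * => /andP[y0 y1].
have aQ : (0 < a <= (Num.truncn c^-1).+1)%N.
  rewrite a0 -(ler_nat R); apply/(le_trans aT)/ltW.
  by apply: le_lt_trans (truncnS_gt c^-1); rewrite lef_pV2 ?posrE// ltW.
have wQ' : digits (Num.truncn c^-1).+1 (a :: w) by rewrite /= aQ.
have xw' : x = cyl (a :: w) y by rewrite /= -Ta.
exists (a :: w); split=> //; first by rewrite /= wn.
rewrite (ltW y1) andbT.
have z01 : 0 <= (0 : R) <= 1 by rewrite lexx ler01.
have y01 : 0 <= y <= 1 by rewrite y0 ltW.
have /andP[_] := cyl_dist wQ' y01 z01.
rewrite -xw' (cylE wQ' z01) !mulr0 !addr0 subr0 (ger0_norm y0).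
have [_ q0 _ _] := dens_bounds wQ'.
(* The fraction tested is the convergent [cyl (a :: w) 0], whose distance to [x] is at most
   [y / den ^ 2]; hence [c < y]. *)
have := xc (nums (a :: w)).2%:Z _ q0; rewrite -pmulrn => h1 h2.
by have := lt_le_trans h1 h2; rewrite ltr_pM2r// invr_gt0 exprn_gt0// ltr0n.
Qed.

Definition quadratic_root (k : int * int * int * bool) : R :=
  let: (a, b, c, e) := k in
  ((-1) ^+ e * Num.sqrt (b%:~R ^+ 2 - 4 * a%:~R * c%:~R) - b%:~R) / (2 * a%:~R).

Lemma quadratic_irrational_root :
  @quadratic_irrational R `<=` range quadratic_root.
Proof.
move=> x [_ _ [a [b [c [a0 abc]]]]].
have a0' : a%:~R != 0 :> R by rewrite intr_eq0.
(* The square of [2 a x + b] is the discriminant, so its sign selects the root. *)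
exists (a, b, c, 2 * a%:~R * x + b%:~R < 0) => //=.
rewrite (_ : b%:~R ^+ 2 - _ = (2 * a%:~R * x + b%:~R) ^+ 2); last first.
  have -> : c%:~R = - (a%:~R * x ^+ 2 + b%:~R * x).
    by move: abc => /eqP; rewrite addrC addr_eq0 => /eqP.
  by ring.
rewrite sqrtr_sqr; have [h|h] := ltP.
  by rewrite ltr0_norm// expr1; field.
by rewrite ger0_norm// expr0; field.
Qed.

End BadlyApproximableCylinders.

(** * Covering the limsup set for one target and one digit bound *)

Section Convergence.
Context {R : realType} (psi : nat -> R) (s : R).
Hypothesis psi_ge0 : forall n, (0 < n)%N -> 0 <= psi n.
Hypothesis psi_nonincreasing : forall m n, (0 < m <= n)%N -> psi n <= psi m.
Hypothesis s0 : 0 <= s.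
Variables (alpha : R) (Q : nat).

Definition level_sum n : R := \sum_(a : n.-tuple 'I_Q)
  Defs.powR0 (psi n) s / (continuant [seq i.+1 | i : 'I_Q <- a])%:R `^ (2 * s).

Definition approx_cylinder n (a : n.-tuple 'I_Q) : set R :=
  [set x | exists t, [/\ 0 <= t <= 1, `|t - alpha| < psi n
    & x = cyl (rev [seq i.+1 | i : 'I_Q <- a]) t]].

Definition cylinder_limsup : set R :=
  [set x | (forall n, exists w, [/\ size w = n, digits Q w,
     0 <= iter n gauss_map x <= 1 & x = cyl w (iter n gauss_map x)]) /\
   infinite_set [set n | `|iter n gauss_map x - alpha| < psi n]].

Lemma powR0_ge0 (x r : R) : 0 <= Defs.powR0 x r.
Proof. by rewrite /Defs.powR0; case: ifP => // _; exact: powR_ge0. Qed.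

Lemma level_sum_ge0 n : 0 <= level_sum n.
Proof.
by apply: sumr_ge0 => a _; rewrite divr_ge0 ?powR0_ge0 ?powR_ge0.
Qed.

Lemma tuple_digits n (a : n.-tuple 'I_Q) :
  digits Q (rev [seq i.+1 | i : 'I_Q <- a]).
Proof. by rewrite all_rev all_map; apply/allP => i _ /=. Qed.

Lemma diam_approx_cylinder n (a : n.-tuple 'I_Q) :
  (diam (approx_cylinder a) <=
   (2 * psi n / (continuant [seq i.+1 | i : 'I_Q <- a])%:R ^+ 2)%:E)%E.
Proof.
apply: diam_le => x y [t [t01 ta ->]] [u [u01 ua ->]].
have wQ := tuple_digits a.
have /andP[_ h] := cyl_dist wQ t01 u01; apply: le_trans h _.
rewrite denE ler_wpM2r ?invr_ge0//.
have := ler_distD alpha t u; rewrite (distrC alpha u); lra.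
Qed.

Lemma continuant_bounds n (a : n.-tuple 'I_Q) :
  (0 < continuant [seq i.+1 | i : 'I_Q <- a])%N /\
  (n <= continuant [seq i.+1 | i : 'I_Q <- a])%N.
Proof.
have [_ h1 h2 _] := dens_bounds (tuple_digits a).
by rewrite -denE; split=> //; move: h2; rewrite size_rev size_map size_tuple.
Qed.

Lemma weight_approx_cylinder n (a : n.-tuple 'I_Q) : (0 < n)%N ->
  (hausdorff_weight s (approx_cylinder a) <=
   (2 `^ s * (Defs.powR0 (psi n) s /
     (continuant [seq i.+1 | i : 'I_Q <- a])%:R `^ (2 * s)))%:E)%E.
Proof.
move=> n0; have [q0 _] := continuant_bounds a.
set q := continuant _ in q0 *; rewrite /hausdorff_weight; case: ifPn => [_|].
  by rewrite lee_fin mulr_ge0 ?powR_ge0// divr_ge0 ?powR0_ge0 ?powR_ge0.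
move=> /set0P[x Fx]; have [t [_ ta _]] := Fx.
(* A nonempty piece forces [psi n > 0], where [powR0] is the ordinary power; this matters for
   [s = 0]. *)
have psi0 : 0 < psi n by apply: le_lt_trans ta.
rewrite /Defs.powR0 gt_eqF//.
have -> : 2 `^ s * (psi n `^ s / q%:R `^ (2 * s)) = (2 * psi n / q%:R ^+ 2) `^ s.
  have psi0' := ltW psi0.
  rewrite [RHS]powRM ?mulr_ge0 ?invr_ge0 ?exprn_ge0// [in RHS]powRM// -mulrA.
  congr (_ * (_ * _)).
  rewrite -[in RHS]powR_inv1 ?exprn_ge0// -[in RHS]powRrM mulN1r powRN; congr (_^-1).
  by rewrite -powR_mulrn// -powRrM.
rewrite -poweR_EFin; apply: gt0_ler_poweR => //; last exact: diam_approx_cylinder.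
  by rewrite in_itv/= leey andbT diam_ge0//; exists x.
by rewrite in_itv/= leey andbT lee_fin divr_ge0// mulr_ge0// ltW.
Qed.

(** The pieces of all levels [n >= N] cover the set. Their diameters are at most [2 psi(1) / N ^ 2],
    because [psi] decreases and continuants of length [n] are at least [n]. *)
Lemma cylinder_limsup_content_tail d N : (0 < N)%N ->
  2 * psi 1%N / N%:R ^+ 2 <= d ->
  (hausdorff_content s d cylinder_limsup <=
   (2 `^ s)%:E * \sum_(N <= n <oo) (level_sum n)%:E)%E.
Proof.
move=> N0 Nd.
have diam_d n (a : n.-tuple 'I_Q) : (N <= n)%N -> (diam (approx_cylinder a) <= d%:E)%E.
  move=> Nn; apply: (le_trans (diam_approx_cylinder a)); rewrite lee_fin.
  apply: le_trans Nd; have [q0 nq] := continuant_bounds a.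
  have n0 := leq_trans N0 Nn.
  apply: ler_pM; rewrite ?mulr_ge0 ?psi_ge0 ?invr_ge0//.
    by rewrite ler_pM2l// psi_nonincreasing.
  rewrite lef_pV2 ?posrE ?exprn_gt0 ?ltr0n// lerXn2r ?nnegrE// ler_nat.
  exact: leq_trans nq.
pose A n := if (N <= n)%N then \bigcup_(a : n.-tuple 'I_Q) approx_cylinder a else set0.
apply: (@le_trans _ _ (hausdorff_content s d (\bigcup_n A n))).
  apply: hausdorff_contentS => x [xcyl /infinite_set_natP/(_ N)[n Nn xn]].
  exists n => //; rewrite /A Nn; have [w [wn wQ x01 xw]] := xcyl n.
  (* ['I_Q] must be inhabited before digits are shifted down into it; a word of length [n >= N > 0]
     has a digit. *)
  have w0 : (0 < Q)%N.
    by case: w wn wQ {xw} => [|b w] /= wn; [lia|case/andP; lia].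
  have szv : size [seq insubd (Ordinal w0) i.-1 | i <- rev w] == n.
    by rewrite size_map size_rev wn.
  exists (Tuple szv) => //; exists (iter n gauss_map x); split=> //=.
  rewrite -map_comp map_id_in ?revK// => i; rewrite mem_rev => iw /=.
  by have /allP/(_ _ iw)/andP[i0 iQ] := wQ; rewrite val_insubd; case: ifP; lia.
apply: (le_trans (hausdorff_content_sigma_subadditive s d A)).
rewrite -nneseriesZl; last by move=> i _; rewrite lee_fin level_sum_ge0.
rewrite [leRHS]eseries_cond [leRHS]eseries_mkcond /=.
apply: lee_nneseries => [n _ _|n _]; first exact: hausdorff_content_ge0.
rewrite /A; case: ifPn => [Nn|_]; last first.
  rewrite (_ : set0 = \bigcup_(t : 'I_0) @set0 R); last by rewrite bigcup0.
  apply: (le_trans (hausdorff_content_bigcup_fin _ _)); last by rewrite big_ord0.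
  by move=> _; exact: diam0_le.
apply: (le_trans (hausdorff_content_bigcup_fin _ _)) => [a|]; first exact: diam_d.
rewrite -EFinM mulr_sumr -sumEFin; apply: lee_sum => a _.
exact: weight_approx_cylinder (leq_trans N0 Nn).
Qed.

Lemma cylinder_limsup_content d : 0 < d ->
  (psi_series psi s Q < +oo)%E -> hausdorff_content s d cylinder_limsup = 0%E.
Proof.
move=> d0 psi_fin; apply/eqP; rewrite eq_le hausdorff_content_ge0 andbT.
have tail : (\sum_(N <= n <oo) (level_sum n)%:E @[N --> \oo] --> 0)%E.
  apply: nneseries_tail_cvg; last by move=> k _; rewrite lee_fin level_sum_ge0.
  (* The tails are those of the sum from 0, whereas [psi_series] starts at 1; the extra term is
     finite. *)
  rewrite nneseries_recl//; last by move=> k _; rewrite lee_fin level_sum_ge0.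
  by rewrite lte_add_pinfty// ltry.
have tail2 : ((2 `^ s)%:E * \sum_(N <= n <oo) (level_sum n)%:E @[N --> \oo] -->
    (2 `^ s)%:E * 0)%E by apply: cvgeZl.
rewrite -(mule0 (2 `^ s)%:E); apply: cvge_ge tail2.
near=> N; apply: cylinder_limsup_content_tail.
  by near: N; exact: nbhs_infty_gt.
have N0 : (0 < N)%N by near: N; exact: nbhs_infty_gt.
have N1 : 2 * psi 1%N / d < N%:R.
  by near: N; exact: nbhs_infty_gtr.
have N2 : 1 <= N%:R :> R by rewrite ler1n.
have N3 : 0 <= 2 * psi 1%N by rewrite mulr_ge0// psi_ge0.
move: N1; rewrite ltr_pdivrMr// => N1.
by rewrite ler_pdivrMr ?exprn_gt0 ?(lt_le_trans _ N2)//; nra.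
Unshelve. all: by end_near. Qed.

End Convergence.

Lemma hausdorff_measure_convergence (R : realType) (psi : nat -> R) (s : R)
    (psi_ge0 : forall n, (0 < n)%N -> 0 <= psi n)
    (psi_nonincreasing : forall m n, (0 < m <= n)%N -> psi n <= psi m)
    (s_ge0 : 0 <= s) :
  (forall Q : nat, (1 <= Q)%N -> (psi_series psi s Q < +oo)%E) ->
  hausdorff_measure s (W psi badly_approximable quadratic_irrational) = 0%E.
Proof.
move=> fin; apply: hausdorff_measure_eq0 => d d0.
apply/eqP; rewrite eq_le hausdorff_content_ge0 andbT.
(* The successor matches the bound [Q.+1] of [badly_approximable_cyl] and keeps it positive, as the
   hypothesis on the series requires. *)
pose X (k : (int * int * int * bool) * nat) :=
  cylinder_limsup psi (quadratic_root k.1) k.2.+1.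
apply: (@le_trans _ _ (hausdorff_content s d (\bigcup_k X k))).
  apply: hausdorff_contentS => x [xBad [alpha /quadratic_irrational_root[k _ <-] xk]].
  have [Q xQ] := badly_approximable_cyl xBad.
  by exists (k, Q).
rewrite hausdorff_content_bigcup0// => -[k Q].
by apply: cylinder_limsup_content => //; exact: fin.
Qed.

(** * The divergence case *)

(** Consecutive Fibonacci numbers. If both last denominators of a word are at most [v], appending
    [i] ones makes them at most [v] times this pair. *)
Definition fib_pair i : nat * nat := iter i (pair_step 1) (1, 1)%N.

Lemma fib_pairS i :
  fib_pair i.+1 = ((fib_pair i).2, (fib_pair i).2 + (fib_pair i).1)%N.
Proof. by rewrite /fib_pair iterS {1}/pair_step mul1n. Qed.

Lemma fib_pair_le i j : (i <= j)%N ->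
  ((fib_pair i).1 <= (fib_pair i).2 /\ 0 < (fib_pair i).1 /\
   (fib_pair i).2 <= (fib_pair j).2)%N.
Proof.
have H k : ((fib_pair k).1 <= (fib_pair k).2 /\ 0 < (fib_pair k).1)%N.
  by elim: k => // k; rewrite fib_pairS /=; lia.
have [h1 h2] := H i; move=> /subnKC <-; split=> //; split=> //.
elim: (j - i)%N => [|k IH]; first by rewrite addn0.
by rewrite addnS fib_pairS /=; lia.
Qed.

(* Stage [e] starts at position [e]: its digits are free up to position [nn e],
   distributed proportionally to [den ^ (- 2 s)], and then [mm (nn e)] digits are
   forced to be 1.  [stage l] holds the starts of the previous and of the current
   stage at position [l]. *)
Section Stages.
Context (nn mm : nat -> nat).
Hypothesis nn_gt : forall e, (e < nn e)%N.

Definition stage_end e := (nn e + mm (nn e))%N.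

Fixpoint stage l : nat * nat :=
  if l is l'.+1 then
    if l == stage_end (stage l').2 then ((stage l').2, l) else stage l'
  else (0, 0)%N.

Lemma stage_end_gt e : (e < stage_end e)%N.
Proof. by rewrite /stage_end; have := nn_gt e; lia. Qed.

Lemma stage_itv l : ((stage l).2 <= l < stage_end (stage l).2)%N.
Proof.
elim: l => [|l IH] /=; first exact: stage_end_gt.
by case: eqP => [_|ne] /=; [rewrite leqnn stage_end_gt|lia].
Qed.

Lemma stage_le l : ((stage l).1 <= (stage l).2)%N.
Proof.
elim: l => //= l IH; case: eqP => //= _.
by have /andP[h _] := stage_itv l; lia.
Qed.

Lemma stage_const l k : (l <= k < stage_end (stage l).2)%N -> stage k = stage l.
Proof.
elim: k => [|k IH]; first by rewrite leqn0 => /andP[/eqP->].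
move=> /andP[]; rewrite leq_eqVlt => /orP[/eqP<-//|lk] kend /=.
by rewrite IH; [case: eqP => // kE; lia|lia].
Qed.

Lemma stage_at_end l :
  stage (stage_end (stage l).2) = ((stage l).2, stage_end (stage l).2).
Proof.
have /andP[h1 h2] := stage_itv l.
have [k Ek] : exists k, stage_end (stage l).2 = k.+1.
  by exists (stage_end (stage l).2).-1; lia.
by rewrite {1}Ek /= (@stage_const l k) ?Ek ?eqxx//; lia.
Qed.

(** Starts never decrease, and after two stage ends beyond [K] even the previous start exceeds
    [K]. *)
Lemma stage_unbounded K : exists N, forall l, (N <= l)%N -> (K <= (stage l).1)%N.
Proof.
pose f := stage_end (stage K).2; have fE := stage_at_end K; rewrite -/f in fE.
exists (stage_end f) => l /subnKC <-; elim: (l - _)%N => [|k IH].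
  have := stage_at_end f; rewrite fE /= addn0 => ->/=.
  by have := stage_itv K; rewrite -/f; lia.
rewrite addnS /=; case: ifP => //= _.
exact: leq_trans IH (stage_le _).
Qed.

End Stages.

(** * The staged mass distribution and its decay *)

Section StagedMass.
Context {R : realType} (s : R) (M : nat) (nn mm : nat -> nat).
Hypothesis s0 : 0 <= s.
Hypothesis M0 : (0 < M)%N.

Local Notation S j := (ext_sum s M j 0 1).
Local Notation wt := (den_weight s).
Local Notation stage_end := (stage_end nn mm).
Local Notation stage := (stage nn mm).

Hypothesis ext_sum_ge1 : forall j, 1 <= S j.
Hypothesis nn_gt : forall e, (e < nn e)%N.
(** The free digits of stage [e] must outweigh three losses: the quasi-multiplicativity constant,
    the denominator of the entering word (at most [(M + 1) ^ e]), and the forced ones. A factor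
    [e + 1] is left over. *)
Hypothesis nn_large : forall e,
  e.+1%:R <= S (nn e - e) * (wt 2 * wt (M.+1 ^ e) * wt (fib_pair (mm (nn e))).2).

(** At a free position, the conditional probability of [a] is the share of the extensions through
    [a] in the weighted sum over all extensions up to the end of the free block. *)
Definition digit_prob l (q : nat * nat) a : R :=
  if (nn (stage l).2 - l)%N is r.+1
  then ext_sum s M r q.2 (a * q.2 + q.1) / ext_sum s M r.+1 q.1 q.2
  else (a == 1)%:R.

Fixpoint mass (w : seq nat) : R :=
  if w is a :: w' then mass w' * digit_prob (size w') (dens w') a else 1.

Lemma digit_prob_ge0 l w a : digits M w -> (0 < a)%N ->
  0 <= digit_prob l (dens w) a.
Proof.
move=> wM a0; rewrite /digit_prob; case: (_ - _)%N => [|r]; first by [].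
have [_ d0 _ _] := dens_bounds wM; rewrite -/(den w).
by apply: divr_ge0; apply: ext_sum_ge0 => //; nia.
Qed.

Lemma mass_ge0 w : digits M w -> 0 <= mass w.
Proof.
elim: w => //= a w IH /andP[/andP[a0 _] wM].
by rewrite mulr_ge0 ?IH// digit_prob_ge0.
Qed.

Lemma mass_sum w : digits M w -> \sum_(i < M) mass (i.+1 :: w) = mass w.
Proof.
move=> wM; rewrite /= -mulr_sumr -[RHS]mulr1; congr (_ * _).
rewrite /digit_prob; case: (_ - _)%N => [|r].
  by case: M M0 => // M' _; rewrite big_ord_recl big1 ?addr0.
have [_ d0 _ _] := dens_bounds wM; rewrite -mulr_suml -/(den w).
have : 0 < ext_sum s M r.+1 (dens w).1 (den w) by exact: ext_sum_gt0.
move=> h; rewrite [X in X / _](_ : _ = ext_sum s M r.+1 (dens w).1 (den w))//.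
by rewrite divff// gt_eqF.
Qed.

Lemma mass_le1 w : digits M w -> mass w <= 1.
Proof.
elim: w => //= a w IH /andP[/andP[a0 aM] wM]; apply: le_trans (IH wM).
rewrite -[leRHS](mass_sum wM).
have aM' : (a.-1 < M)%N by lia.
rewrite (bigD1 (Ordinal aM'))//= prednK// lerDl.
by apply: sumr_ge0 => i _; rewrite mulr_ge0 ?mass_ge0// digit_prob_ge0.
Qed.

Let bound e x : R := x / (wt 2 * S (nn e - e)).

(** In the free block the ratio of mass to extension sum does not change, so a bound at entry
    persists. The value [eta] comes from the previous stage and controls the free block; the other
    comes from [mass <= 1] and controls the forced block through [nn_large]. In the forced block the
    mass stays constant or vanishes, while denominators grow at most like Fibonacci numbers. *)
Let stage_inv eta e w :=
  ((size w <= nn e)%N ->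
    forall x, (x = eta \/ x = (wt (M.+1 ^ e))^-1) ->
    mass w <= bound e x * ext_sum s M (nn e - size w) (dens w).1 (den w)) /\
  ((nn e <= size w)%N -> exists2 v0, (0 < v0)%N &
    [/\ mass w <= bound e (wt (M.+1 ^ e))^-1 * wt v0,
        ((dens w).1 <= v0 * (fib_pair (size w - nn e)).1)%N
      & (den w <= v0 * (fib_pair (size w - nn e)).2)%N]).

Let wt_gt0 v : (0 < v)%N -> 0 < wt v. Proof. exact: den_weight_gt0. Qed.
Let S_gt0 j : 0 < S j. Proof. exact: lt_le_trans (ext_sum_ge1 j). Qed.
Let wtB_gt0 e : 0 < wt (M.+1 ^ e). Proof. by apply: wt_gt0; rewrite expn_gt0. Qed.

Let boundM_gt0 e : 0 < wt 2 * S (nn e - e).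
Proof. by rewrite mulr_gt0// wt_gt0. Qed.

Let bound_ge0 e x : 0 <= x -> 0 <= bound e x.
Proof. by move=> x0; rewrite divr_ge0// ltW. Qed.

Let stage_inv_enter eta e w : digits M w -> size w = e -> 0 <= eta ->
  mass w <= eta * wt (den w) -> stage_inv eta e w.
Proof.
move=> wM we eta0 mw; split; last by rewrite we leqNgt nn_gt.
have [d1 d0 _ dB] := dens_bounds wM.
move=> _ x xE; have x0 : 0 <= x by case: xE => ->//; rewrite invr_ge0 ltW.
have mwx : mass w <= x * wt (den w).
  case: xE => ->//; apply: (le_trans (mass_le1 wM)).
  rewrite mulrC ler_pdivlMr// mul1r; apply: den_weight_le => //.
  by rewrite d0 -we.
apply: (le_trans mwx); rewrite /bound mulrAC -!mulrA ler_wpM2l// mulrC.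
rewrite mulrC ler_pdivlMr// we.
have := ext_sum_ge_root s0 M (nn e - e) d0 d1; lra.
Qed.

Let stage_inv_step eta e w a : digits M (a :: w) -> 0 <= eta ->
  (stage (size w)).2 = e -> stage_inv eta e w -> stage_inv eta e (a :: w).
Proof.
move=> /= /andP[/andP[a0 aM] wM] eta0 we [h1 h2].
have [d1 d0 _ _] := dens_bounds wM.
have free : (size w < nn e)%N -> forall x, (x = eta \/ x = (wt (M.+1 ^ e))^-1) ->
    mass (a :: w) <=
    bound e x * ext_sum s M (nn e - (size w).+1) (den w) (a * den w + (dens w).1).
  move=> wn x xE /=; rewrite /digit_prob we; move: (h1 (ltnW wn) x xE).
  have -> : (nn e - size w = (nn e - (size w).+1).+1)%N by lia.
  set r := (nn e - _)%N => mw; rewrite -/(den w).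
  have G0 : 0 < ext_sum s M r.+1 (dens w).1 (den w) by exact: ext_sum_gt0.
  rewrite mulrA ler_pdivrMr// mulrAC; apply: ler_wpM2r => //.
  by apply: ext_sum_ge0 => //; nia.
split; first exact: free.
rewrite /=; case: (ltnP (size w) (nn e)) => [wn nw|nw _].
  have e0 : (nn e - (size w).+1 = 0)%N by lia.
  have := free wn _ (or_intror erefl); rewrite e0 /= => mw.
  exists (den (a :: w)); first by rewrite /den/= -/(den w); nia.
  have -> : ((size w).+1 - nn e = 0)%N by lia.
  by rewrite /= !muln1; split=> //; rewrite /den /= -/(den w); nia.
rewrite /digit_prob we; have -> : (nn e - size w = 0)%N by lia.
have -> : ((size w).+1 - nn e = (size w - nn e).+1)%N by lia.
have [f1 [f2 _]] := fib_pair_le (leqnn (size w - nn e)).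
rewrite /den/= -/(den w); have [->|a1] := eqVneq a 1%N.
  have [v0 v00 [m1 m2 m3]] := h2 nw; exists v0 => //.
  by rewrite mulr1 !mul1n; split=> //; lia.
(* A forced digit other than 1 gives mass 0, so the new denominator itself can serve as [v0]. *)
exists (a * den w + (dens w).1)%N; first by nia.
have f3 : (0 < (fib_pair (size w - nn e)).2)%N by lia.
rewrite mulr0 !mul1n; split; last by apply: leq_pmulr; lia.
  2: by apply: leq_trans (leq_pmulr _ f3); nia.
by apply: mulr_ge0; [apply: bound_ge0; rewrite invr_ge0 ltW|apply/ltW/wt_gt0; nia].
Qed.

Let stage_inv_forced eta e w : digits M w -> (nn e <= size w <= stage_end e)%N ->
  stage_inv eta e w -> mass w <= e.+1%:R^-1 * wt (den w).
Proof.
move=> wM /andP[nw we] [_ /(_ nw)[v0 v00 [mw _ dw]]].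
have [_ d0 _ _] := dens_bounds wM.
set i := (size w - nn e)%N in dw; have im : (i <= mm (nn e))%N.
  by rewrite /i; move: we; rewrite /stage_end; lia.
have [f1 [f2 f3]] := fib_pair_le im.
have f0 : (0 < (fib_pair i).2)%N by lia.
have h1 : wt v0 * wt (fib_pair (mm (nn e))).2 <= wt (den w).
  apply: (@le_trans _ _ (wt v0 * wt (fib_pair i).2)).
    by rewrite ler_pM2l ?wt_gt0//; apply: den_weight_le; rewrite // f0.
  by rewrite -den_weightM; apply: den_weight_le => //; rewrite d0.
apply: (le_trans mw); rewrite mulrC ler_pdivlMl ?ltr0n//.
apply: le_trans h1; rewrite mulrCA; apply: ler_wpM2l; first exact/ltW/wt_gt0.
have := nn_large e; rewrite /bound => h.
rewrite mulrA ler_pdivrMr ?mulr_gt0 ?wt_gt0// ler_pdivrMr//.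
by rewrite (le_trans h)// le_eqVlt; apply/orP; left; apply/eqP; ring.
Qed.

(** When stage [e] ends, [stage_inv_forced] supplies the factor [1 / (e + 1)] with which the next
    stage is entered; [e] is then the previous start. *)
Let mass_stage_inv w : digits M w ->
  stage_inv (stage (size w)).1.+1%:R^-1 (stage (size w)).2 w.
Proof.
elim: w => [_|a w IH] /=.
  by apply: stage_inv_enter => //=; rewrite invr1 mul1r /den/= den_weight1.
move=> awM; have /andP[_ wM] := awM.
have eta0 : 0 <= (stage (size w)).1.+1%:R^-1 :> R by rewrite invr_ge0.
have inv := stage_inv_step awM eta0 erefl (IH wM).
case: eqP => [lE|_]; last exact: inv.
apply: stage_inv_enter => //.
apply: (@stage_inv_forced _ (stage (size w)).2 (a :: w) awM _ inv).
by rewrite [size (a :: w)]/= lE leqnn andbT leq_addr.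
Qed.

Lemma mass_bound eta : 0 < eta ->
  exists N, forall w, digits M w -> (N <= size w)%N ->
    mass w <= eta * wt (den w).
Proof.
(* One factor [wt 2] comes from the lower bound at entry to the stage, the other from splitting the
   free block at [size w] by supermultiplicativity. *)
move=> eta0; pose x := (eta * (wt 2 * wt 2))^-1.
have [N HN] := stage_unbounded mm nn_gt (Num.truncn x).+1; exists N => w wM Nw.
have w22 : 0 < wt 2 * wt 2 by rewrite mulr_gt0// wt_gt0.
have w21 : wt 2 * wt 2 <= 1.
  by apply: mulr_ile1; rewrite ?den_weight_le1// ltW// wt_gt0.
have [d1 d0 _ _] := dens_bounds wM.
have := HN _ Nw; have := mass_stage_inv wM; have := stage_itv mm nn_gt (size w).
have := stage_le mm nn_gt (size w); case: (stage _) => h e /= he /andP[ew we] inv Kh.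
have xh : h.+1%:R^-1 <= eta * (wt 2 * wt 2).
  rewrite invf_ple ?posrE ?ltr0n ?mulr_gt0 ?wt_gt0//; apply/ltW.
  apply: (lt_le_trans (truncnS_gt _)); rewrite ler_nat.
  by apply: leq_trans Kh _.
have [wn|nw] := leqP (size w) (nn e); last first.
  apply: (le_trans (stage_inv_forced wM _ inv)); first by rewrite (ltnW nw) (ltnW we).
  apply: ler_wpM2r; first exact/ltW/wt_gt0.
  apply: (@le_trans _ _ h.+1%:R^-1).
    by rewrite lef_pV2 ?posrE ?ltr0n// ler_nat.
  by apply: (le_trans xh); rewrite ler_piMr// ltW.
have [/(_ wn _ (or_introl erefl)) mw _] := inv.
apply: (le_trans mw).
have h1 := ext_sum_le_root s0 M (nn e - size w) (dens w).1 d0.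
have := ext_sum_supermul s0 M (size w - e) (nn e - size w)
  (isT : (0 < 1)%N) (isT : (0 <= 1)%N).
have -> : (size w - e + (nn e - size w) = nn e - e)%N by lia.
move=> h2; have h3 : wt 2 * S (nn e - size w) <= S (nn e - e).
  by apply: le_trans h2; rewrite ler_pM2l ?wt_gt0// ler_peMl// ltW.
rewrite /bound; apply: (@le_trans _ _ (h.+1%:R^-1 / (wt 2 * S (nn e - e)) *
   (wt (den w) * S (nn e - size w)))).
  by apply: ler_wpM2l => //; apply: bound_ge0.
rewrite mulrAC ler_pdivrMr//.
apply: (@le_trans _ _ (eta * (wt 2 * wt 2) * (wt (den w) * S (nn e - size w)))).
  by apply: ler_wpM2r => //; rewrite mulr_ge0 ?ltW ?wt_gt0.
have -> : eta * (wt 2 * wt 2) * (wt (den w) * S (nn e - size w)) =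
  eta * wt (den w) * (wt 2 * (wt 2 * S (nn e - size w))) by ring.
apply: ler_wpM2l; first by apply: mulr_ge0; [exact: ltW|exact/ltW/wt_gt0].
by rewrite ler_pM2l ?wt_gt0.
Qed.

(** In a forced block only the digit 1 has positive probability, and such blocks occur arbitrarily
    late. *)
Lemma mass_branch_ones a : (forall l, 0 < mass (prefix_word a l)) ->
  forall N, exists2 n, (N <= n)%N & forall i, (i < mm n)%N -> a (n + i)%N = 1%N.
Proof.
move=> a0 N; pose f := stage_end (stage N).2.
have fE : (stage f).2 = f by rewrite (stage_at_end mm nn_gt).
have Nf : (N < f)%N by have /andP[] := stage_itv mm nn_gt N.
exists (nn f) => [|i im]; first by have := nn_gt f; lia.
have := a0 (nn f + i).+1; rewrite prefix_wordS /= size_prefix_word /digit_prob.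
rewrite (@stage_const nn mm f); last by rewrite fE /stage_end; have := nn_gt f; lia.
rewrite fE; have -> : (nn f - (nn f + i) = 0)%N by lia.
by case: eqP => // _; rewrite mulr0 ltxx.
Qed.

End StagedMass.

(** * A branch avoiding words of small total mass *)

Section AvoidingBranch.
Context {R : realType} (M : nat) (nu : seq nat -> R).
Hypothesis nu_nil : nu [::] = 1.
Hypothesis nu_ge0 : forall w, digits M w -> 0 <= nu w.
Hypothesis nu_sum : forall w, digits M w -> \sum_(i < M) nu (i.+1 :: w) = nu w.

(* The mass of the words that extend both [v] and [w]. *)
Definition common_mass (v w : seq nat) : R :=
  if suffix v w then nu w else if suffix w v then nu v else 0.

Lemma common_mass_ge0 v w : digits M v -> digits M w -> 0 <= common_mass v w.
Proof.
move=> vM wM; rewrite /common_mass; case: ifP => _; first exact: nu_ge0.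
by case: ifP => _ //; exact: nu_ge0.
Qed.

Lemma common_mass_nil v : common_mass v [::] = nu v.
Proof. by rewrite /common_mass suffix0s suffixs0; case: eqP => [->|]. Qed.

Lemma suffix_cons_cases (T : eqType) (v w : seq T) a :
  suffix v (a :: w) -> suffix v w \/ v = a :: w.
Proof.
move=> /suffixP[[|b u] /=]; first by right.
by move=> [_ ->]; left; apply/suffixP; exists u.
Qed.

Lemma suffix_cons_uniq (T : eqType) (v w : seq T) a b :
  suffix (a :: w) v -> suffix (b :: w) v -> a = b.
Proof.
move=> /suffixP[u1 e1] /suffixP[u2]; rewrite e1 -!cat_rcons => e.
have := congr1 rev e; rewrite !rev_cat => /eqP; rewrite eqseq_cat// => /andP[_].
by rewrite !rev_rcons => /eqP[].
Qed.

(** If [w] already extends [v], this is additivity of [nu]. Otherwise at most one child of [w] is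
    compatible with [v], and it contributes [nu v]. *)
Lemma common_mass_sum v w : digits M v -> digits M w ->
  \sum_(i < M) common_mass v (i.+1 :: w) <= common_mass v w.
Proof.
move=> vM wM; rewrite {2}/common_mass; case: ifPn => [vw|nvw].
  rewrite -(nu_sum wM) le_eqVlt; apply/orP; left; apply/eqP; apply: eq_bigr => i _.
  rewrite /common_mass ifT//; have /suffixP[u ->] := vw.
  by apply/suffixP; exists (i.+1 :: u).
have cE (i : 'I_M) : common_mass v (i.+1 :: w) =
    if suffix (i.+1 :: w) v then nu v else 0.
  rewrite /common_mass; case: ifPn => // /suffix_cons_cases[|vE].
    by rewrite (negPf nvw).
  by rewrite -vE suffix_refl.
under eq_bigr do rewrite cE.
rewrite -big_mkcond/=; have [i0 Pi0|P0] := pickP (fun i : 'I_M => suffix (i.+1 :: w) v).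
  rewrite (big_pred1 i0) => [|i].
    rewrite ifT//; have /suffixP[u ->] := Pi0.
    by apply/suffixP; exists (rcons u i0.+1); rewrite cat_rcons.
  apply/idP/eqP => [Pi|->//]; apply/val_inj.
  by have /succn_inj := suffix_cons_uniq Pi Pi0.
by rewrite big_pred0//; case: ifP => _ //; exact: nu_ge0.
Qed.

(** [Phi w] bounds the mass below [w] taken up by the forbidden words. If [Phi w < nu w], summing
    over the children shows that some child satisfies it too. Following such children never reaches
    [ws i], where the common mass would equal [nu (ws i)]. *)
Lemma exists_avoiding_branch (ws : nat -> seq nat) : (forall i, digits M (ws i)) ->
  (\sum_(0 <= i <oo) (nu (ws i))%:E < 1)%E ->
  exists a, [/\ forall i, (0 < a i <= M)%N, forall l, 0 < nu (prefix_word a l)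
    & forall i, prefix_word a (size (ws i)) != ws i].
Proof.
move=> wsM ws1; pose Phi w := (\sum_(0 <= i <oo) (common_mass (ws i) w)%:E)%E.
have cm0 w i : digits M w -> (0 <= (common_mass (ws i) w)%:E)%E.
  by move=> wM; rewrite lee_fin common_mass_ge0.
pose good w := digits M w /\ (Phi w < (nu w)%:E)%E.
have good_nil : good [::].
  split=> //; rewrite nu_nil; apply: le_lt_trans ws1.
  by apply: lee_nneseries => [i _ _|i _]; rewrite ?cm0// common_mass_nil.
have step w : exists a, good w -> (0 < a <= M)%N /\ good (a :: w).
  have [gw|] := pselect (good w); last by exists 0%N.
  have [wM Phiw] := gw; apply: contrapT => noa.
  have noa' (i : 'I_M) : ((nu (i.+1 :: w))%:E <= Phi (i.+1 :: w))%E.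
    rewrite leNgt; apply/negP => h; apply: noa; exists i.+1 => _.
    have iM : (0 < i.+1 <= M)%N by rewrite /=.
    by split=> //; split=> //; rewrite /= wM andbT.
  have : (\sum_(i < M) (nu (i.+1 :: w))%:E <= Phi w)%E.
    apply: (@le_trans _ _ (\sum_(i < M) Phi (i.+1 :: w))%E); first exact: lee_sum.
    rewrite -nneseries_sum; last first.
      by move=> i j _; apply: cm0; rewrite /= wM andbT.
    apply: lee_nneseries => [j _ _|j _].
      by apply: sume_ge0 => i _; apply: cm0; rewrite /= wM andbT.
    by rewrite sumEFin lee_fin common_mass_sum.
  by rewrite sumEFin nu_sum// leNgt Phiw.
have [next nextP] := choice step.
pose W n := iter n (fun w => next w :: w) [::].
have goodW n : good (W n).
  by elim: n => [|n IH]; [exact: good_nil|case: (nextP _ IH)].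
have WE n : prefix_word (fun n => next (W n)) n = W n.
  by elim: n => [|n IH]; [|rewrite prefix_wordS IH].
have massW n i : common_mass (ws i) (W n) < nu (W n).
  have [WM] := goodW n; rewrite -lte_fin; apply: le_lt_trans.
  have := @nneseries_lim_ge R (fun i => (common_mass (ws i) (W n))%:E) xpredT 0 i.+1.
  rewrite big_nat_recr//= => h; apply: le_trans (h _); last by move=> j *; exact: cm0.
  by rewrite leeDr// sume_ge0// => j *; exact: cm0.
exists (fun n => next (W n)); split=> [n|n|i].
- by have [] := nextP _ (goodW n).
- rewrite WE; have [WM] := goodW n; rewrite -lte_fin; apply: le_lt_trans.
  by apply: nneseries_ge0 => j _ _; exact: cm0.
- apply/eqP => e; have := massW (size (ws i)) i.
  by rewrite -WE e /common_mass suffix_refl ltxx.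
Qed.

End AvoidingBranch.

(** * The mass distribution principle *)

Section ContentLowerBound.
Context {R : realType} (s : R) (M : nat) (nu : seq nat -> R).
Hypothesis s0 : 0 <= s.
Hypothesis M0 : (0 < M)%N.
Hypothesis nu_nil : nu [::] = 1.
Hypothesis nu_ge0 : forall w, digits M w -> 0 <= nu w.
Hypothesis nu_sum : forall w, digits M w -> \sum_(i < M) nu (i.+1 :: w) = nu w.
Hypothesis nu_bound : forall eta, 0 < eta -> exists N, forall w, digits M w ->
  (N <= size w)%N -> nu w <= eta * den_weight s (den w).
Variable E : set R.
Hypothesis E_branch : forall a, (forall i, (0 < a i <= M)%N) ->
  (forall l, 0 < nu (prefix_word a l)) -> E (cf_value a).

Let K : R := 4 * M.+1%:R ^+ 3.

Let K0 : 0 < K. Proof. by rewrite mulr_gt0// exprn_gt0// ltr0n. Qed.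

Let in_branch (F : set R) a :=
  [/\ forall i, (0 < a i <= M)%N, forall l, 0 < nu (prefix_word a l) & F (cf_value a)].

(* The word is the longest common prefix of the branches in [F], or a long prefix
   when they all coincide. *)
Let common_prefix (eta e : R) N (F : set R) : 0 < eta -> 0 < e ->
  (forall w, digits M w -> (N <= size w)%N -> nu w <= eta * den_weight s (den w)) ->
  (diam F <= ((2 * K * (M.+1 ^ N)%:R ^+ 2)^-1)%:E)%E ->
  exists w, [/\ digits M w,
    forall a, in_branch F a -> prefix_word a (size w) = w
    & ((nu w)%:E <= (eta * K `^ s)%:E * hausdorff_weight s F + e%:E)%E].
Proof.
move=> eta0 e0 HN dF.
have [[n nP]|allEq] := pselect (exists n, exists a b,
    [/\ in_branch F a, in_branch F b & a n != b n]).
  have nP' : exists n, `[< exists a b, [/\ in_branch F a, in_branch F b & a n != b n] >].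
    by exists n; apply/asboolP.
  case: (ex_minnP nP') => {n nP nP'} n /asboolP[a [b [aF bF abn]]] nmin.
  have agree c i : in_branch F c -> (i < n)%N -> c i = a i.
    move=> cF ilt; apply/eqP; apply: contraTT ilt => ca; rewrite -leqNgt; apply: nmin.
    by apply/asboolP; exists c, a.
  have [aM _ Fa] := aF; have [bM _ Fb] := bF.
  exists (prefix_word a n); have wM := digits_prefix_word n aM.
  split=> // [c cF|].
    by rewrite size_prefix_word; apply: eq_prefix_word => i; exact: agree.
  have sep := cf_value_separation aM bM (fun i ilt => esym (agree _ _ bF ilt)) abn.
  set w := prefix_word a n in wM sep *; rewrite -/K in sep.
  have [_ d0 _ dB] := dens_bounds wM.
  have d1 : 1 <= (den w)%:R :> R by rewrite ler1n.
  have dsep : (((K * (den w)%:R ^+ 2)^-1)%:E <= diam F)%E.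
    by apply: le_trans (diam_ge Fa Fb); rewrite lee_fin.
  have p0 : 0 < K * (den w)%:R ^+ 2 by rewrite mulr_gt0// exprn_gt0// (lt_le_trans ltr01).
  (* A shorter common prefix would separate [a] and [b] by more than the diameter allowed; the
     factor 2 in that diameter makes the contradiction strict. *)
  have Nw : (N <= size w)%N.
    rewrite leqNgt; apply/negP => wN.
    have : (den w)%:R <= (M.+1 ^ N)%:R :> R.
      by rewrite ler_nat (leq_trans dB)// leq_pexp2l// ltnW.
    have := le_trans dsep dF; rewrite lee_fin.
    rewrite lef_pV2 ?posrE//; last by rewrite !mulr_gt0// exprn_gt0// ltr0n expn_gt0.
    by rewrite (mulrC 2) -mulrA ler_pM2l//; nra.
  have Fne : F != set0 by apply/set0P; exists (cf_value a).
  rewrite /hausdorff_weight (negPf Fne).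
  apply: (@le_trans _ _ ((eta * K `^ s)%:E * (((K * (den w)%:R ^+ 2)^-1) `^ s)%:E + e%:E)%E).
    rewrite -EFinM -EFinD lee_fin; apply: (le_trans (HN w wM Nw)).
    rewrite -mulrA -powRM ?invr_ge0 ?(ltW K0) ?(ltW p0)//.
    have -> : K * (K * (den w)%:R ^+ 2)^-1 = ((den w)%:R ^+ 2)^-1.
      by rewrite invfM mulrA divff ?mul1r// gt_eqF.
    rewrite -[in leRHS]powR_inv1 ?exprn_ge0// -[in leRHS]powRrM mulN1r powRN.
    by rewrite -powR_mulrn// -powRrM /den_weight lerDl ltW.
  rewrite leeD2r// lee_pmul2l//; last by rewrite lte_fin mulr_gt0// powR_gt0.
  rewrite -poweR_EFin; apply: gt0_ler_poweR => //.
    by rewrite in_itv/= leey andbT lee_fin invr_ge0 ltW.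
  by rewrite in_itv/= leey andbT diam_ge0//; exact/set0P.
(* At most one branch meets [F], whose weight may be 0; a long prefix of mass at most [e] is charged
   to the additive term. *)
have [N' HN'] := nu_bound e0.
have [a aM aF] : exists2 a, (forall i, (0 < a i <= M)%N) & forall c, in_branch F c ->
    forall i, c i = a i.
  have [[a aF]|noF] := pselect (exists a, in_branch F a).
    exists a => [|c cF i]; first by case: aF.
    by apply: contrapT => /eqP ca; apply: allEq; exists i, c, a.
  by exists (fun=> 1%N) => // c cF; exfalso; apply: noF; exists c.
exists (prefix_word a N'); have wM := digits_prefix_word N' aM; split=> // [c cF|].
  by rewrite size_prefix_word; apply: eq_prefix_word => i _; exact: aF.
have h : nu (prefix_word a N') <= e.
  apply: (le_trans (HN' _ wM _)); first by rewrite size_prefix_word.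
  have [_ d0 _ _] := dens_bounds wM.
  by rewrite ler_piMr ?den_weight_le1// ltW.
rewrite (@le_trans _ _ e%:E)// ?lee_fin// leeDr// mule_ge0// ?hausdorff_weight_ge0//.
by rewrite lee_fin mulr_ge0 ?powR_ge0// ltW.
Qed.

Lemma hausdorff_measure_branches : hausdorff_measure s E = +oo%E.
Proof.
apply: hausdorff_measure_eqy => L L0.
have Ks0 : 0 < K `^ s by exact: powR_gt0.
(* A cover of weight below [L] then accounts for mass at most [1 / 4], and the errors [e0] below sum
   to [1 / 2]. *)
pose eta := (4 * L * K `^ s)^-1.
have eta0 : 0 < eta by rewrite invr_gt0 !mulr_gt0.
have [N HN] := nu_bound eta0.
have d0 : 0 < (2 * K * (M.+1 ^ N)%:R ^+ 2)^-1 :> R.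
  by rewrite invr_gt0 !mulr_gt0// exprn_gt0// ltr0n expn_gt0.
exists (2 * K * (M.+1 ^ N)%:R ^+ 2)^-1 => //.
rewrite leNgt; apply/negP => /ereal_inf_lt[_ [F [EF dF] <-] FL].
have e0 i : 0 < 2^-1 / (2 ^ i.+1)%:R :> R by rewrite divr_gt0// ltr0n expn_gt0.
have [ws wsP] := choice (fun i => common_prefix eta0 (e0 i) HN (dF i)).
have wsM i : digits M (ws i) by have [] := wsP i.
have ws1 : (\sum_(0 <= i <oo) (nu (ws i))%:E < 1)%E.
  apply: (@le_lt_trans _ _ (\sum_(0 <= i <oo) ((eta * K `^ s)%:E *
      hausdorff_weight s (F i) + (2^-1 / (2 ^ i.+1)%:R)%:E))%E).
    by apply: lee_nneseries => [i _ _|i _]; [rewrite lee_fin nu_ge0|have [] := wsP i].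
  have hw0 i : (0 <= (eta * K `^ s)%:E * hausdorff_weight s (F i))%E.
    by rewrite mule_ge0 ?hausdorff_weight_ge0// lee_fin mulr_ge0 ?ltW.
  apply: (le_lt_trans (epsilon_trick xpredT hw0 _)) => //.
  rewrite nneseriesZl; last by move=> i _; exact: hausdorff_weight_ge0.
  apply: (@le_lt_trans _ _ ((eta * K `^ s)%:E * L%:E + 2^-1%:E)%E).
    by rewrite leeD2r// lee_wpmul2l ?lee_fin ?mulr_ge0 ?ltW.
  have -> : eta * K `^ s = (4 * L)^-1.
    by rewrite /eta invfM mulfVK// gt_eqF.
  rewrite -EFinM -EFinD lte_fin invfM mulfVK ?gt_eqF//.
  by lra.
have [a [aM a0 aws]] := exists_avoiding_branch nu_nil nu_ge0 nu_sum wsM ws1.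
have [i _ Fia] := EF _ (E_branch aM a0).
have [_ /(_ a) h _] := wsP i.
by have /eqP := aws i; apply; apply: h.
Qed.

End ContentLowerBound.

(** * Bounded digits imply bad approximability *)

Section BoundedDigitsBad.
Context {R : realType} (Q : nat) (a : nat -> nat).
Hypothesis aQ : forall i, (0 < a i <= Q)%N.

(* [p / q] is compared with the first convergent whose denominator is at least
   [2 q]: the two fractions differ, while [x] is much closer to the convergent. *)
Lemma cf_value_badly_approximable : badly_approximable (cf_value a : R).
Proof.
have /andP[x0 x1] := @cf_value_bounds R _ _ aQ.
split; first by rewrite (ltW x1) andbT (lt_le_trans _ x0)// invr_gt0 ltr0n.
have C0 : 0 < 8 * Q.+1%:R :> R by rewrite mulr_gt0// ltr0n.
(* The distance will be at least [1 / (2 q d)] with [d <= 2 (Q + 1) q]; 8 in place of 4 makes the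
   inequality strict. *)
exists (8 * Q.+1%:R)^-1; first by rewrite invr_gt0.
move=> p q q0.
have [n qn nmin] : exists2 n, (2 * q <= den (prefix_word a n))%N &
    forall k, (2 * q <= den (prefix_word a k))%N -> (n <= k)%N.
  have ex : exists n, (2 * q <= den (prefix_word a n))%N.
    exists (2 * q)%N; have [_ _ h _] := dens_bounds (digits_prefix_word (2 * q) aQ).
    by rewrite -{1}(size_prefix_word a (2 * q)).
  by case: (ex_minnP ex) => n; exists n.
have qnQ : (den (prefix_word a n) <= Q.+1 * (2 * q))%N.
  case: n qn nmin => [|n] qn nmin; first by rewrite /den /=; lia.
  have qn' : (den (prefix_word a n) < 2 * q)%N.
    by rewrite ltnNge; apply/negP => /nmin; rewrite ltnn.
  rewrite prefix_wordS /den /= -/(den _).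
  have [h1 h2 _ _] := dens_bounds (digits_prefix_word n aQ).
  by have /andP[_ h3] := aQ n; nia.
have wQ := digits_prefix_word n aQ; set w := prefix_word a n in qn qnQ wQ.
have [_ d0 _ _] := dens_bounds wQ.
have z01 : 0 <= (0 : R) <= 1 by rewrite lexx ler01.
have t01 := @cf_value01 R _ _ (shift_digits n aQ).
have /andP[_] := cyl_dist wQ t01 z01.
rewrite -(cf_value_cyl n aQ) (cylE wQ z01) !mulr0 !addr0 subr0.
move/andP: t01 => [t0 t1]; rewrite (ger0_norm t0) => close.
(* Numerator and denominator of a convergent are coprime by the determinant identity, so equality
   would make [den w >= 2 q] divide [q]. *)
have neq : p * (den w)%:Z - (nums w).2%:Z * q%:Z != 0.
  apply/eqP => e; have dvd : (den w %| q)%N.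
    have : ((den w)%:Z %| q%:Z)%Z.
      have -> : q%:Z = (-1) ^+ (size w).+1 *
          (p * (dens w).1%:Z - (nums w).1%:Z * q%:Z) * (den w)%:Z.
        have sgn : (-1) ^+ (size w).+1 * (-1) ^+ (size w).+1 = 1 :> int.
          by rewrite -expr2 sqrr_sign.
        transitivity ((-1) ^+ (size w).+1 * (-1) ^+ (size w).+1 * q%:Z).
          by rewrite sgn mul1r.
        rewrite -!mulrA; congr (_ * _); rewrite -det_nums_dens.
        have e' : p * (den w)%:Z = (nums w).2%:Z * q%:Z by apply/eqP; rewrite -subr_eq0 e.
        transitivity ((nums w).2%:Z * q%:Z * (dens w).1%:Z -
          (nums w).1%:Z * (den w)%:Z * q%:Z); first by ring.
        by rewrite -e'; ring.
      exact: dvdz_mull.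
    by [].
  by have := dvdn_leq q0 dvd; lia.
set X := (nums w).2%:R / (den w)%:R in close *.
have q0' : 0 < q%:R :> R by rewrite ltr0n.
have d0' : 0 < (den w)%:R :> R by rewrite ltr0n.
have gap : (q%:R * (den w)%:R)^-1 <= `|X - p%:~R / q%:R|.
  have -> : X - p%:~R / q%:R =
      - (p * (den w)%:Z - (nums w).2%:Z * q%:Z)%:~R / (q%:R * (den w)%:R).
    rewrite rmorphB !rmorphM /= -!pmulrn /X.
    by field; rewrite !gt_eqF.
  rewrite normrM normfV (gtr0_norm (mulr_gt0 q0' d0')) normrN ler_peMl ?invr_ge0 ?mulr_ge0//.
  by rewrite -intr_norm -[1]/(1%:~R) ler_int; move: neq; rewrite -normr_gt0; lia.
have q2 : 2 * q%:R <= (den w)%:R :> R by rewrite -natrM ler_nat.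
have q3 : (den w)%:R <= Q.+1%:R * (2 * q%:R) :> R by rewrite -!natrM ler_nat.
have tri := ler_distD (cf_value a) X (p%:~R / q%:R).
rewrite (distrC X (cf_value a)) in tri.
have close' : cf_value (shift n a) / (den w)%:R ^+ 2 <= (2 * (q%:R * (den w)%:R))^-1 :> R.
  apply: (@le_trans _ _ (1 / (den w)%:R ^+ 2)).
    by rewrite ler_wpM2r// invr_ge0 exprn_ge0.
  rewrite div1r lef_pV2 ?posrE ?exprn_gt0 ?mulr_gt0//.
  by rewrite mulrA expr2 ler_pM2r.
have key : (8 * Q.+1%:R)^-1 / q%:R ^+ 2 < (2 * (q%:R * (den w)%:R))^-1 :> R.
  rewrite -invfM ltf_pV2 ?posrE ?mulr_gt0 ?exprn_gt0//.
  have : q%:R * (den w)%:R <= q%:R * (Q.+1%:R * (2 * q%:R)) :> R by rewrite ler_pM2l.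
  have : 0 < Q.+1%:R * q%:R ^+ 2 :> R by rewrite mulr_gt0 ?exprn_gt0// ltr0n.
  by rewrite expr2; move: (Q.+1%:R) => k; nra.
have half : (q%:R * (den w)%:R)^-1 =
    (2 * (q%:R * (den w)%:R))^-1 + (2 * (q%:R * (den w)%:R))^-1 :> R.
  by field; rewrite !gt_eqF.
move: (le_trans close close') key gap tri; rewrite half.
move: (`|cf_value a - X|) (`|X - _|) (`|cf_value a - _|) (_^-1 / _) (2 * _)^-1.
by move=> x1' x2' x3' x4' x5'; lra.
Qed.

End BoundedDigitsBad.

(** * The golden mean as target *)

Section GoldenMean.
Context {R : realType}.

Definition golden : R := cf_value (fun=> 1%N).

Lemma golden_quadratic_irrational : quadratic_irrational golden.
Proof.
have oD i : (0 < (fun=> 1%N) (i : nat) <= 1)%N by [].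
have /andP[g0 g1] := @cf_value_bounds R _ _ oD; rewrite -/golden in g0 g1.
have bad := @cf_value_badly_approximable R _ _ oD; rewrite -/golden in bad.
split; first by apply/andP; split; [apply: le_trans g0; rewrite invr_ge0|exact: ltW].
  (* A rational number is at distance 0 from itself, so bad approximability implies
     irrationality. *)
  move=> [z _ /= zE]; have [_ [c c0 /(_ (numq z) `|denq z|%N)]] := bad.
  rewrite absz_gt0 denq_eq0 => /(_ isT).
  have -> : `|denq z|%:R = (denq z)%:~R :> R by rewrite pmulrn absz_denq.
  have -> : (numq z)%:~R / (denq z)%:~R = golden by rewrite -zE.
  have h : 0 <= c / (denq z)%:~R ^+ 2 :> R.
    by apply: divr_ge0; [exact: ltW|exact: sqr_ge0].
  by rewrite subrr normr0 ltNge h.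
exists 1, 1, (-1); split=> //.
have gE : golden = (1 + golden)^-1 := @cf_value_shift1 R _ _ oD.
clear oD bad; have g2 : 1 + golden != 0 by rewrite gt_eqF//; lra.
have : golden * (1 + golden) = 1 by rewrite {1}gE mulVf.
by lra.
Qed.

(** Both numbers lie on the inverse branch of [m] ones; strictness holds because their tails lie in
    the open unit interval. *)
Lemma dist_golden Q a n m : (forall i, (0 < a i <= Q)%N) ->
  (forall i, (i < m)%N -> a (n + i)%N = 1%N) ->
  `|cf_value (shift n a) - golden| < (den (prefix_word (fun=> 1%N) m))%:R ^- 2 :> R.
Proof.
move=> aQ a1; have aQn := shift_digits n aQ.
have Q0 : (0 < Q)%N by have := aQ 0%N; lia.
have oD i : (0 < (fun=> 1%N) (i : nat) <= Q)%N by [].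
have e : prefix_word (shift n a) m = prefix_word (fun=> 1%N) m.
  exact: eq_prefix_word.
rewrite /golden (cf_value_cyl m aQn) (cf_value_cyl m oD) e.
have wQ := digits_prefix_word m oD.
have tb := @cf_value_bounds R _ _ (shift_digits m aQn).
have ub := @cf_value_bounds R _ _ (shift_digits m oD).
have k0 : 0 < Q.+1%:R^-1 :> R by rewrite invr_gt0 ltr0n.
move: (@cf_value01 R _ _ (shift_digits m aQn)) (@cf_value01 R _ _ (shift_digits m oD)) tb ub.
set t := cf_value (shift m (shift n a)); set u := cf_value (shift m _).
move=> t01 u01 /andP[t0 t1] /andP[u0 u1].
have /andP[_ h] := cyl_dist wQ t01 u01; apply: (le_lt_trans h).
have [_ d0 _ _] := dens_bounds wQ.
rewrite ltr_pdivrMr ?exprn_gt0 ?ltr0n// mulVf; last by rewrite gt_eqF// exprn_gt0// ltr0n.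
have {}t0 := lt_le_trans k0 t0; have {}u0 := lt_le_trans k0 u0.
by clear oD; rewrite ltr_norml; lra.
Qed.

Lemma fib_pair_ones i : fib_pair i = dens (prefix_word (fun=> 1%N) i.+1).
Proof.
elim: i => // i IH; rewrite [in RHS]prefix_wordS.
by transitivity (pair_step 1 (fib_pair i)); [|rewrite IH].
Qed.

Lemma exists_ones_length (p P : R) : 0 < p <= P -> exists m,
  (den (prefix_word (fun=> 1%N) m))%:R ^- 2 <= p /\
  ((fib_pair m).2)%:R ^+ 2 <= (P + 16) / p.
Proof.
move=> /andP[p0 pP]; have oD i : (0 < (fun=> 1%N) (i : nat) <= 1)%N by [].
pose D m := den (prefix_word (fun=> 1%N) m).
have Db m := dens_bounds (digits_prefix_word m oD); clear oD.
have ex : exists m, (D m)%:R ^- 2 <= p.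
  exists (Num.truncn p^-1).+1; have [_ d0 dm _] := Db (Num.truncn p^-1).+1.
  rewrite size_prefix_word -/(D _) in d0 dm.
  rewrite invf_ple ?posrE ?exprn_gt0 ?ltr0n//.
  have h1 : p^-1 < (Num.truncn p^-1).+1%:R by exact: truncnS_gt.
  have h2 : (Num.truncn p^-1).+1%:R <= (D (Num.truncn p^-1).+1)%:R :> R by rewrite ler_nat.
  have h3 : 1 <= (D (Num.truncn p^-1).+1)%:R :> R by rewrite ler1n.
  by nra.
(* Minimality gives [p * D ^ 2 < 1] one step earlier, and the Fibonacci number is at most [4 D],
   hence 16; the term [P] covers [m = 0]. *)
case: (ex_minnP ex) => m mp mmin; exists m; split=> //.
rewrite ler_pdivlMr//; case: m mp mmin => [|m] mp mmin.
  by rewrite /= expr1n mul1r; lra.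
have : p < (D m)%:R ^- 2 by rewrite ltNge; apply/negP => /mmin; rewrite ltnn.
have [d1 d0 _ _] := Db m; have [d1' d0' _ _] := Db m.+1.
have -> : (fib_pair m.+1).2 = den (prefix_word (fun=> 1%N) m.+2) by rewrite fib_pair_ones.
have -> : den (prefix_word (fun=> 1%N) m.+2) = (D m.+1 + D m)%N.
  by rewrite /D (prefix_wordS _ m.+1) (prefix_wordS _ m) /den /= !mul1n.
have : (D m.+1 + D m <= 4 * D m)%N.
  rewrite /D prefix_wordS /den /= mul1n -/(den _); lia.
rewrite -(ler_nat R) natrM => h4 h5.
have D0 : 0 < (D m)%:R :> R by rewrite ltr0n.
have h6 : p * (D m)%:R ^+ 2 < 1 by rewrite -ltr_pdivlMr ?exprn_gt0// div1r.
have h7 : 0 <= (D m.+1 + D m)%:R :> R by [].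
apply: (@le_trans _ _ ((4 * (D m)%:R) ^+ 2 * p)).
  by rewrite ler_pM2r// lerXn2r ?nnegrE// mulr_ge0// ltW.
by rewrite exprMn; lra.
Qed.

End GoldenMean.

(** * Choice of the stage lengths and conclusion *)

Section Divergence.
Context {R : realType} (psi : nat -> R) (s : R).
Hypothesis psi_ge0 : forall n, (0 < n)%N -> 0 <= psi n.
Hypothesis psi_nonincreasing : forall m n, (0 < m <= n)%N -> psi n <= psi m.
Hypothesis s0 : 0 <= s.

Lemma ext_sum_tuple Q n u v :
  \sum_(a : n.-tuple 'I_Q) den_weight s
    (foldl (fun q ai => (q.2, ai * q.2 + q.1)%N) (u, v)
      [seq i.+1 | i : 'I_Q <- a]).2 = ext_sum s Q n u v.
Proof.
elim: n u v => [|n IH] u v.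
  by rewrite (big_pred1 [tuple]) => // a; apply/esym/eqP/tuple0.
rewrite (reindex (fun p : 'I_Q * n.-tuple 'I_Q => cons_tuple p.1 p.2)) /=; last first.
  exists (fun a : n.+1.-tuple 'I_Q => (thead a, behead_tuple a)) => [[i a] _|a _] /=.
    by congr pair; apply/val_inj.
  by rewrite [RHS]tuple_eta; apply/val_inj.
rewrite -(pair_big xpredT xpredT (fun (i : 'I_Q) (a : n.-tuple 'I_Q) => den_weight s
  (foldl (fun q ai => (q.2, ai * q.2 + q.1)%N) (v, i.+1 * v + u)%N
      [seq j.+1 | j : 'I_Q <- a]).2)) /=.
by apply: eq_bigr => i _; rewrite IH.
Qed.

Lemma level_sumE Q n : 0 < psi n ->
  level_sum psi s Q n = psi n `^ s * ext_sum s Q n 0 1.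
Proof.
move=> psi0; rewrite /level_sum -ext_sum_tuple mulr_sumr; apply: eq_bigr => a _.
by rewrite /Defs.powR0 gt_eqF.
Qed.

Variable Q : nat.
Hypothesis Q0 : (0 < Q)%N.
Hypothesis psi_series_y : psi_series psi s Q = +oo%E.

Let tail_y N : (\sum_(N.+1 <= n <oo) (level_sum psi s Q n)%:E = +oo)%E.
Proof.
have := psi_series_y; rewrite /psi_series -/(level_sum psi s Q).
rewrite (nneseries_split (f := fun n => (level_sum psi s Q n)%:E) 1 N); last first.
  by move=> k _; rewrite lee_fin level_sum_ge0.
rewrite sumEFin add1n; by case: (\sum_(N.+1 <= n <oo) _)%E.
Qed.

(** A zero of [psi] would persist by monotonicity, and the convention [0 ^ 0 = 0] would make the
    whole tail vanish, even for [s = 0]. *)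
Lemma psi_gt0 n : (0 < n)%N -> 0 < psi n.
Proof.
move=> n0; rewrite lt_neqAle psi_ge0// andbT; apply/eqP => psin.
have := tail_y n; rewrite eseries0// => k nk _.
have k0 : psi k = 0.
  apply/eqP; rewrite eq_le psi_ge0 ?andbT; last by lia.
  by rewrite psin psi_nonincreasing//; lia.
by rewrite /level_sum big1// => a _; rewrite /Defs.powR0 k0 eqxx mul0r.
Qed.

Local Notation M := Q.+1.
Local Notation S j := (ext_sum s M j 0 1).
Local Notation wt := (den_weight s).

(* One more admissible digit makes the sums grow faster by an exponential factor,
   so that the divergent series has terms that are not even bounded. *)
Lemma ext_sum_unbounded D e : exists2 n, (e < n)%N & D <= S n * psi n `^ s.
Proof.
apply: contrapT => noD; pose g := ext_gain s Q.
have g1 : 1 < g by exact: ext_gain_gt1.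
have g0 : 0 < g by apply: lt_trans g1.
(* If all later products stay below [D], the gain from the extra digit makes the series
   geometric. *)
have bnd n : (e < n)%N -> level_sum psi s Q n <= D * g^-1 ^+ n.
  move=> en; rewrite level_sumE ?psi_gt0//; last by lia.
  rewrite exprVn ler_pdivlMr ?exprn_gt0//.
  have h := ext_sum_gain s0 n Q0 (isT : (0 < 1)%N) (isT : (0 <= 1)%N).
  apply: (@le_trans _ _ (psi n `^ s * S n)).
    by rewrite -mulrA ler_wpM2l ?powR_ge0// mulrC.
  by rewrite mulrC leNgt; apply/negP => /ltW h'; apply: noD; exists n.
have := tail_y e; suff : (\sum_(e.+1 <= n <oo) (level_sum psi s Q n)%:E < +oo)%E.
  by move=> + h; rewrite h ltxx.
have D0 : 0 <= D * g^-1 ^+ e.+1.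
  by apply: le_trans (bnd _ (ltnSn e)); exact: level_sum_ge0.
have {}D0 : 0 <= D by move: D0; rewrite pmulr_lge0// exprn_gt0// invr_gt0.
have geo0 n : (0 <= (D * g^-1 ^+ n)%:E)%E.
  by rewrite lee_fin mulr_ge0// exprn_ge0// invr_ge0 ltW.
apply: (@le_lt_trans _ _ (\sum_(0 <= n <oo) (D * g^-1 ^+ n)%:E)%E).
  rewrite [leLHS]eseries_cond [leLHS]eseries_mkcond /=.
  apply: lee_nneseries => [n _ _|n _].
    by case: ifP => // _; rewrite lee_fin level_sum_ge0.
  by case: ifP => //= en; rewrite lee_fin; exact: bnd.
have cg : cvgn (series (geometric D g^-1)).
  by apply: is_cvg_geometric_series; rewrite gtr0_norm ?invr_gt0// invf_lt1.
rewrite (_ : (fun n => _) = EFin \o series (geometric D g^-1)); last first.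
  by apply/funext => n; rewrite /= /series /= sumEFin.
by rewrite EFin_lim// ltry.
Qed.

(** If some [S j < 1], submultiplicativity bounds every [S n] by the sum of the first [j] values,
    contradicting [ext_sum_unbounded] as [psi n <= psi 1]. *)
Lemma ext_sum_ge1 j : 1 <= S j.
Proof.
rewrite leNgt; apply/negP => Sj1.
have j0 : (0 < j)%N by case: j Sj1 => //=; rewrite den_weight1 ltxx.
pose C := \sum_(r < j) S r.
have SC n : S n <= C.
  elim/ltn_ind: n => n IH; have [nj|jn] := ltnP n j.
    rewrite /C (bigD1 (Ordinal nj))//= lerDl.
    by apply: sumr_ge0 => i _; exact: ext_sum_ge0.
  have /IH : (n - j < n)%N by lia.
  apply: le_trans; rewrite -{1}(subnKC jn).
  apply: (le_trans (ext_sum_submul s0 M j (n - j) 0 (isT : (0 < 1)%N))).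
  by rewrite ler_piMl ?ext_sum_ge0// ltW.
have psi1 := @psi_gt0 1%N isT.
have p0 : 0 < psi 1%N `^ s by exact: powR_gt0.
have [n n0] := ext_sum_unbounded ((C + 1) * psi 1%N `^ s) 0.
apply/negP; rewrite -ltNge; apply: (@le_lt_trans _ _ (C * psi 1%N `^ s)).
  apply: ler_pM; rewrite ?ext_sum_ge0 ?powR_ge0//.
  by apply: ge0_ler_powR; rewrite ?nnegrE ?psi_ge0// psi_nonincreasing// n0.
by rewrite ltr_pM2r// ltrDl.
Qed.

Lemma exists_ones_lengths : exists mm : nat -> nat, forall n, (0 < n)%N ->
  (den (prefix_word (fun=> 1%N) (mm n)))%:R ^- 2 <= psi n /\
  psi n `^ s <= (psi 1%N + 16) `^ s * wt (fib_pair (mm n)).2.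
Proof.
suff /choice[mm mmP] : forall n, exists m, (0 < n)%N ->
    (den (prefix_word (fun=> 1%N) m))%:R ^- 2 <= psi n /\
    psi n `^ s <= (psi 1%N + 16) `^ s * wt (fib_pair m).2 by exists mm.
move=> n; case: (posnP n) => [->|n0]; first by exists 0%N.
have p0 := psi_gt0 n0.
have [|m [m1 m2]] := @exists_ones_length R (psi n) (psi 1%N).
  by rewrite p0 psi_nonincreasing.
exists m => _; split=> //.
have [f1 [f2 _]] := fib_pair_le (leqnn m).
have f0 : 0 < ((fib_pair m).2)%:R :> R by rewrite ltr0n; lia.
rewrite ler_pdivlMr// in m2.
rewrite /den_weight powRrM powR_mulrn ?(ltW f0)// ler_pdivlMr ?powR_gt0 ?exprn_gt0//.
rewrite -powRM ?(ltW p0) ?exprn_ge0 ?(ltW f0)// mulrC; apply: ge0_ler_powR => //.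
  by rewrite nnegrE mulr_ge0 ?exprn_ge0 ?(ltW f0) ?(ltW p0).
by rewrite nnegrE addr_ge0// psi_ge0.
Qed.

Lemma exists_stage_lengths (mm : nat -> nat) :
  (forall n, (0 < n)%N ->
    psi n `^ s <= (psi 1%N + 16) `^ s * wt (fib_pair (mm n)).2) ->
  exists nn : nat -> nat, forall e, (e < nn e)%N /\
    e.+1%:R <= S (nn e - e) * (wt 2 * wt (M.+1 ^ e) * wt (fib_pair (mm (nn e))).2).
Proof.
move=> mmP; suff /choice[nn nnP] : forall e, exists n, (e < n)%N /\
    e.+1%:R <= S (n - e) * (wt 2 * wt (M.+1 ^ e) * wt (fib_pair (mm n)).2).
  by exists nn.
move=> e; set K := (psi 1%N + 16) `^ s in mmP.
have K0 : 0 < K by rewrite powR_gt0// ltr_wpDl// psi_ge0.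
pose c := wt 2 * wt (M.+1 ^ e).
have c0 : 0 < c by rewrite mulr_gt0// den_weight_gt0// expn_gt0.
have Se : 0 < S e by apply: lt_le_trans (ext_sum_ge1 e).
(* The threshold absorbs [S e], lost in passing from [S n] to [S (n - e)], the constant [K] relating
   [psi n] to the number of ones, and the entry factor [c]. *)
have [n en nD] := ext_sum_unbounded (e.+1%:R * S e * K / c) e.
exists n; split=> //; have Sn := ext_sum_submul s0 M e (n - e) 0 (isT : (0 < 1)%N).
rewrite subnKC in Sn; last exact: ltnW.
have n0 : (0 < n)%N by lia.
have Sne := ext_sum_ge1 (n - e); have := mmP n n0.
move: nD; rewrite ler_pdivrMr// -/c.
set f := wt _; set p := psi n `^ s => nD pf.
have h1 : S n * p <= S e * S (n - e) * (K * f).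
  by apply: ler_pM => //; [exact: ext_sum_ge0|exact: powR_ge0].
have h2 : e.+1%:R * (S e * K) <= S (n - e) * (c * f) * (S e * K).
  have := ler_wpM2r (ltW c0) h1; move: nD; rewrite !mulrA => nD h3.
  apply: (le_trans nD); apply: (le_trans h3).
  by rewrite le_eqVlt; apply/orP; left; apply/eqP; ring.
by rewrite ler_pM2r ?mulr_gt0// in h2.
Qed.

Lemma hausdorff_measure_divergence :
  hausdorff_measure s (W psi badly_approximable quadratic_irrational) = +oo%E.
Proof.
have [mm mmP] := exists_ones_lengths.
have [nn nnP] := exists_stage_lengths (fun n n0 => (mmP n n0).2).
have nn_gt e : (e < nn e)%N := (nnP e).1.
have nn_large e := (nnP e).2.
pose nu := mass s M nn mm.
apply: (@hausdorff_measure_branches R s M nu) => //.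
- by move=> w wM; exact: mass_ge0.
- by move=> w wM; exact: mass_sum.
- by move=> eta eta0; exact: (mass_bound s0 _ ext_sum_ge1 nn_gt nn_large).
move=> a aM a0; split; first exact: (@cf_value_badly_approximable R M a aM).
exists golden; first exact: golden_quadratic_irrational.
apply/infinite_set_natP => N.
(* Asking for [N.+1] guarantees [n > 0], where [mmP] applies. *)
have [n Nn an] := mass_branch_ones s0 (ltn0Sn Q) nn_gt a0 N.+1.
exists n; first exact: ltnW.
rewrite /= (iter_gauss_map_cf_value n aM).
apply: lt_le_trans (dist_golden aM an) _.
by have [] := mmP n (leq_ltn_trans (leq0n N) Nn).
Qed.

End Divergence.

Theorem theorem8p1 (R : realType) (psi : nat -> R) (s : R)
    (psi_ge0 : forall n, (0 < n)%N -> 0 <= psi n)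
    (psi_nonincreasing : forall m n, (0 < m <= n)%N -> psi n <= psi m)
    (s_ge0 : 0 <= s) :
  ((forall Q : nat, (1 <= Q)%N -> (psi_series psi s Q < +oo)%E) ->
     hausdorff_measure s (W psi badly_approximable quadratic_irrational) = 0%E)
  /\
  ((exists2 Q : nat, (1 <= Q)%N & psi_series psi s Q = +oo%E) ->
     hausdorff_measure s (W psi badly_approximable quadratic_irrational)
     = +oo%E).
Proof.
split; first exact: hausdorff_measure_convergence.
by move=> [Q Q0]; exact: hausdorff_measure_divergence.
Qed.
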